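(* Let $B_n=\binom{2n}{n}$, $n=0,1,2,\ldots$ (so $B_0=1$). Then: (a) $\{B_n\}_{n=0}^{\infty}$ is an infinitely divisible Stieltjes moment sequence. (b) If a random variable $X$ has moment sequence $\{B_n\}_{n=0}^\infty$ (i.e. $E[X^n]=B_n$ for all $n$), then $X$ has density $$f(x)=\frac{1}{\pi}\frac{1}{\sqrt{x(4-x)}},\quad x\in(0,4),$$ and moment generating function $$M(t)=E[e^{tX}]=\sum_{n=0}^\infty B_n\frac{t^n}{n!}=e^{2t}I_0(2t),\quad t\in\mathbb{R},$$ where $I_\alpha(t)=\sum_{k=0}^\infty (t/2)^{2k+\alpha}/(k!\,\Gamma(k+\alpha+1))$ is the modified Bessel function of the first kind. (c) For each real $c>0$, the power sequence $\{B_n^c\}_{n=0}^\infty$ is Stieltjes determinate. (d) For each real $c>0$, the (unique) measure $\mu_c$ on $[0,\infty)$ with moment sequence $\{B_n^c\}_{n=0}^\infty$ has Mellin transform $$\int_0^\infty t^s\,d\mu_c(t)=\left(\frac{2^{2s}}{\sqrt{\pi}}\cdot\frac{\Gamma(s+1/2)}{\Gamma(s+1)}\right)^c=\left(\frac{\Gamma(2s+1)}{(\Gamma(s+1))^2}\right)^c,\quad s\ge0.$$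
   Context: A real sequence $\{m_n\}_{n=0}^\infty$ is a Stieltjes moment sequence if there is a nonnegative measure $\mu$ on $[0,\infty)$ with $m_n=\int_{[0,\infty)}x^n\,d\mu(x)$ for all $n\ge0$; it is Stieltjes determinate if such $\mu$ is unique. A Stieltjes moment sequence $\{m_n\}$ is infinitely divisible (in the sense of Tyan) if $\{m_n^c\}_{n=0}^\infty$ is a Stieltjes moment sequence for every real $c>0$. *)

(* Defs.v *)
From mathcomp Require Export all_boot all_order all_algebra.
From mathcomp Require Export all_classical all_reals all_analysis.

Set Implicit Arguments.
Unset Strict Implicit.
Unset Printing Implicit Defensive.

Import Order.TTheory GRing.Theory Num.Theory.
Import numFieldNormedType.Exports.

Local Open Scope classical_set_scope.
Local Open Scope ring_scope.

(* A nonnegative measure on [0, +oo) is represented by a Borel measure on R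
   that does not charge the negative half-line. *)
Definition has_Stieltjes_moments (R : realType)
    (mu : {measure set (measurableTypeR R) -> \bar R}) (m : nat -> R) : Prop :=
  mu `]-oo, 0[%classic = 0%E /\
  forall n, (\int[mu]_(x in `[0%R, +oo[) (x ^+ n)%:E = (m n)%:E)%E.

Definition Stieltjes_moment_sequence (R : realType) (m : nat -> R) : Prop :=
  exists mu : {measure set (measurableTypeR R) -> \bar R},
    has_Stieltjes_moments mu m.

Definition Stieltjes_determinate (R : realType) (m : nat -> R) : Prop :=
  Stieltjes_moment_sequence m /\
  forall mu nu : {measure set (measurableTypeR R) -> \bar R},
    has_Stieltjes_moments mu m -> has_Stieltjes_moments nu m ->
    forall A, measurable A -> mu A = nu A.

(* Infinite divisibility in the sense of Tyan. *)
Definition infinitely_divisible_Stieltjes (R : realType) (m : nat -> R) : Prop :=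
  Stieltjes_moment_sequence m /\
  forall c : R, 0 < c -> Stieltjes_moment_sequence (fun n => m n `^ c).

Definition central_binomial (R : realType) (n : nat) : R := 'C(2 * n, n)%:R.

Definition has_density (R : realType) (d : measure_display)
    (T : measurableType d) (P : probability T R) (X : {RV P >-> R})
    (f : R -> R) : Prop :=
  [/\ measurable_fun setT f, forall x, 0 <= f x &
    forall A : set R, measurable A ->
      distribution P X A = (\int[lebesgue_measure]_(x in A) (f x)%:E)%E].

(* Euler's integral, the value of Gamma for s > 0 only. *)
Definition Gamma (R : realType) (s : R) : R :=
  \int[lebesgue_measure]_(x in `]0, +oo[) (x `^ (s - 1) * expR (- x)).

(* The order is restricted to naturals so that (t / 2) ^ (2k + a) makes sense
   for every real t, including t < 0. *)
Definition besselI (R : realType) (a : nat) (t : R) : R :=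
  limn (series (fun k : nat =>
    (t / 2) ^+ (2 * k + a) / (k`!%:R * Gamma (k%:R + a%:R + 1)))).

(* Main.v *)
(* With r(s) = Gamma(s + 1/2) / (sqrt pi * Gamma(s + 1)) one has B_n = 4^n r(n),
   and r(s) is the limit over J of r(J) prod_(j < J) (s + j + 1) / (s + j + 1/2).
   Each factor has a completely monotone logarithm, hence r(n h)^c is a
   completely monotone sequence for all c, h > 0, and by Hausdorff's theorem it
   is the moment sequence of some variable Q in [0, 1].  For h = 1/q the variable
   4^c Q^q has moments B_n^c, and its moments of order p/q are also known.  The
   bound B_n^c <= (4^c)^n forces every solution of the moment problem to have
   compact support, hence determinacy; so the Mellin transform is known at
   rational points, and at all s >= 0 by dominated convergence.  The arcsine
   density has moments B_n, which identifies the law for c = 1; expanding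
   E[exp (t (X - 2))] in powers of t gives the Bessel series, since
   E[(X - 2)^m] is the coefficient of x^m in ((1 + x)^2 - 2 x)^m = (1 + x^2)^m. *)
From HB Require Import structures.
Require Import Defs.
From mathcomp Require Import ring lra zify measurable_realfun.
Set Implicit Arguments.
Unset Strict Implicit.
Unset Printing Implicit Defensive.
Import Order.TTheory GRing.Theory Num.Theory.
Import numFieldNormedType.Exports.
Local Open Scope classical_set_scope.
Local Open Scope ring_scope.

(** * Completely monotone sequences and their closure properties *)

Section completely_monotone.
Context {R : realType}.
Implicit Types (a b : nat -> R) (k n : nat).

(** No compactness of spaces of measures is used. Hausdorff's theorem yields a monotone quantile
    function on [0, 1] rather than a measure: pointwise limits along one ultrafilter suffice, and
    the law is a pushforward of the uniform law, so that its powers are explicit. Determinacy rests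
    on explicit polynomials converging boundedly to indicators of half-lines. All asymptotics of
    [Gamma] come from Wendel's inequality [Gamma (x + t) <= x^t Gamma x] for [0 <= t <= 1], that is
    from convexity alone. It gives positivity, right continuity and [r(s + J) / r(J) -> 1]; it also
    gives Legendre's duplication formula, since the quotient of its two sides has period 1/2 and
    tends to 1. The exponent c enters only as a positive factor of a logarithm, so all c > 0 are
    treated alike. The laws obtained for different q are a priori unrelated; they solve the same
    moment problem, and determinacy merges them into one measure whose moments of every rational
    order are known. *)

Definition fdiff a : nat -> R := fun n => a n - a n.+1.

(** The order is bounded so that products and reciprocals can be handled by induction on [k]: their
    first difference is built from sequences of the same kind, one order lower. *)
Definition monotone_upto k a := forall j n, (j <= k)%N -> 0 <= iter j fdiff a n.

Definition completely_monotone a := forall j n, 0 <= iter j fdiff a n.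

Lemma completely_monotoneP a :
  completely_monotone a <-> forall k, monotone_upto k a.
Proof. by split=> [h k j n _|h j n]; [exact: h|exact: (h j)]. Qed.

Lemma fdiffD a b : fdiff (a \+ b) = fdiff a \+ fdiff b.
Proof. by apply/funext => n; rewrite /fdiff /=; ring. Qed.

Lemma iter_fdiffD j a b : iter j fdiff (a \+ b) = iter j fdiff a \+ iter j fdiff b.
Proof. by elim: j => //= j ->; rewrite fdiffD. Qed.

Lemma iter_fdiffZ j (c : R) a :
  iter j fdiff (fun n => c * a n) = fun n => c * iter j fdiff a n.
Proof. by elim: j => //= j ->; apply/funext => n; rewrite /fdiff mulrBr. Qed.

Lemma iter_fdiff_shift j a :
  iter j fdiff (fun n => a n.+1) = fun n => iter j fdiff a n.+1.
Proof. by elim: j => //= j ->. Qed.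

Lemma monotone_uptoD k a b : monotone_upto k a -> monotone_upto k b ->
  monotone_upto k (a \+ b).
Proof. by move=> ha hb j n jk; rewrite iter_fdiffD addr_ge0 ?ha ?hb. Qed.

Lemma monotone_uptoZ k (c : R) a : 0 <= c -> monotone_upto k a ->
  monotone_upto k (fun n => c * a n).
Proof. by move=> c0 ha j n jk; rewrite iter_fdiffZ mulr_ge0 ?ha. Qed.

Lemma monotone_uptoS k a : monotone_upto k.+1 a ->
  [/\ monotone_upto k a, monotone_upto k (fdiff a) &
      monotone_upto k (fun n => a n.+1)].
Proof.
move=> ha; split=> j n jk; first by apply: ha; exact: leqW.
- by rewrite -iterSr; exact: ha.
- by rewrite iter_fdiff_shift; apply: ha; exact: leqW.
Qed.

Lemma monotone_upto_fdiff k a : (forall n, 0 <= a n) ->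
  monotone_upto k (fdiff a) -> monotone_upto k.+1 a.
Proof. by move=> a0 ha [|j] n jk //; rewrite iterSr; exact: ha. Qed.

(** Leibniz rule: the first difference of a product is [fdiff a] times [b] plus the shift of [a]
    times [fdiff b], and the induction hypothesis applies to both products. *)
Lemma monotone_uptoM k a b : monotone_upto k a -> monotone_upto k b ->
  monotone_upto k (fun n => a n * b n).
Proof.
elim: k a b => [|k IH] a b ha hb.
  by move=> j n; rewrite leqn0 => /eqP ->/=; rewrite mulr_ge0 ?(ha 0%N) ?(hb 0%N).
apply: monotone_upto_fdiff => [n|]; first by rewrite mulr_ge0 ?(ha 0%N) ?(hb 0%N).
have [ha0 ha1 ha2] := monotone_uptoS ha; have [hb0 hb1 hb2] := monotone_uptoS hb.
rewrite (_ : fdiff _ =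
    (fun n => fdiff a n * b n) \+ (fun n => a n.+1 * fdiff b n)).
  by apply: monotone_uptoD; exact: IH.
by apply/funext => n; rewrite /fdiff /=; ring.
Qed.

Lemma completely_monotone_cst (c : R) : 0 <= c -> completely_monotone (fun=> c).
Proof.
move=> c0 [|j] n //.
have -> : iter j.+1 fdiff (fun=> c) = fun=> 0; last exact: lexx.
by elim: j => [|j /= ->]; apply/funext => m; rewrite /fdiff /= subrr.
Qed.

Lemma completely_monotoneD a b : completely_monotone a -> completely_monotone b ->
  completely_monotone (fun n => a n + b n).
Proof. by move=> ha hb j n; rewrite iter_fdiffD addr_ge0 ?ha ?hb. Qed.

Lemma completely_monotoneZ (c : R) a : 0 <= c -> completely_monotone a ->
  completely_monotone (fun n => c * a n).
Proof. by move=> c0 ha j n; rewrite iter_fdiffZ mulr_ge0 ?ha. Qed.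

Lemma completely_monotoneM a b : completely_monotone a -> completely_monotone b ->
  completely_monotone (fun n => a n * b n).
Proof.
move=> /completely_monotoneP ha /completely_monotoneP hb.
by apply/completely_monotoneP => k; exact: monotone_uptoM.
Qed.

Lemma completely_monotoneX m a : completely_monotone a ->
  completely_monotone (fun n => a n ^+ m).
Proof.
move=> ha; elim: m => [|m IH].
  rewrite (_ : (fun n => _) = fun=> 1); first exact: completely_monotone_cst.
  by apply/funext => n; rewrite expr0.
rewrite (_ : (fun n => _) = fun n => a n * a n ^+ m); first exact: completely_monotoneM.
by apply/funext => n; rewrite exprS.
Qed.

Lemma completely_monotone_sum m (F : nat -> nat -> R) :
  (forall i, completely_monotone (F i)) ->
  completely_monotone (fun n => \sum_(i < m) F i n).
Proof.
move=> hF; elim: m => [|m IH].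
  rewrite (_ : (fun n => _) = fun=> 0); first exact: completely_monotone_cst.
  by apply/funext => n; rewrite big_ord0.
rewrite (_ : (fun n => _) = fun n => \sum_(i < m) F i n + F m n).
  exact: completely_monotoneD.
by apply/funext => n; rewrite big_ord_recr.
Qed.

Lemma completely_monotone_lim (F : nat -> nat -> R) a :
  (forall m, completely_monotone (F m)) ->
  (forall n, F ^~ n @ \oo --> a n) -> completely_monotone a.
Proof.
move=> hF Fa j n.
have : (fun m => iter j fdiff (F m) n) @ \oo --> iter j fdiff a n.
  by elim: j n => //= j IH n; exact: cvgB.
move=> cF; rewrite -(cvg_lim _ cF)//; apply: limr_ge; first by apply/cvg_ex; exists (iter j fdiff a n).
by apply: nearW => m; exact: hF.
Qed.

(** Since [1/x - 1/(x + h) = h / (x (x + h))], the first difference is a multiple of a product of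
    two sequences of the same form, with constants [b] and [b + h]; hence the induction on the order
    generalises [b]. *)
Lemma completely_monotone_inv (h b : R) : 0 < h -> 0 < b ->
  completely_monotone (fun n => (n%:R * h + b)^-1).
Proof.
move=> h0 b0; apply/completely_monotoneP => k.
elim: k b b0 => [|k IH] b b0.
  move=> j n; rewrite leqn0 => /eqP -> /=.
  by rewrite invr_ge0 addr_ge0 ?mulr_ge0 // ltW.
apply: monotone_upto_fdiff => [n|].
  by rewrite invr_ge0 addr_ge0 ?mulr_ge0 // ltW.
rewrite (_ : fdiff _ =
    fun n => h * ((n%:R * h + b)^-1 * (n%:R * h + (b + h))^-1)).
  apply: monotone_uptoZ; first exact: ltW.
  by apply: monotone_uptoM; apply: IH => //; exact: addr_gt0.
apply/funext => n; rewrite /fdiff.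
have n0 : 0 <= n%:R * h by rewrite mulr_ge0 // ltW.
rewrite -[n.+1%:R]natr1; field; apply/andP; split; apply: lt0r_neq0; lra.
Qed.

(** The exponential series has nonnegative coefficients, and sums, products and pointwise limits
    preserve complete monotonicity. *)
Lemma completely_monotone_expR a : completely_monotone a ->
  completely_monotone (fun n => expR (a n)).
Proof.
move=> ha.
apply: (@completely_monotone_lim (fun m n => \sum_(i < m) i`!%:R^-1 * a n ^+ i)).
  move=> m; apply: (@completely_monotone_sum m (fun i n => i`!%:R^-1 * a n ^+ i)) => i.
  by apply: completely_monotoneZ; [rewrite invr_ge0|exact: completely_monotoneX].
move=> n; have := is_cvg_series_exp_coeff (a n).
move=> cu; apply: cvg_trans cu.
apply: near_eq_cvg; apply: nearW => m /=.
by rewrite /series /= big_mkord; apply: eq_bigr => i _; rewrite /exp_coeff /= mulrC.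
Qed.

(* Riemann sums of [ln ((x + b) / (x + a)) = \int_a^b du / (x + u)]. *)
Lemma ln_ratio_riemann (x a b : R) m : 0 <= x -> 0 < a -> a < b ->
  `| ln ((x + b) / (x + a)) - \sum_(i < m.+1)
       (b - a) / m.+1%:R * (x + (a + i%:R * ((b - a) / m.+1%:R)))^-1 |
    <= (b - a) / m.+1%:R / a.
Proof.
move=> x0 a0 ab; set d := (b - a) / m.+1%:R.
have d0 : 0 < d by rewrite divr_gt0 // subr_gt0.
have pos i : 0 < x + (a + i%:R * d).
  by rewrite ltr_wpDl// ltr_pwDl// mulr_ge0// ltW.
(* The integrand decreases, so the left-endpoint sum exceeds the integral. The right-endpoint sum,
   which is too small, differs from it by the last term minus the first: this telescoped gap is the
   lower bound. *)
suff main k : let e := ln ((x + (a + k%:R * d)) / (x + a)) -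
                 \sum_(i < k) d * (x + (a + i%:R * d))^-1 in
    e <= 0 /\ d * (x + (a + k%:R * d))^-1 - d / (x + a) <= e.
  have [] := main m.+1; rewrite /d mulrCA divff ?mulr1 ?pnatr_eq0// subrKC -/d.
  set e := ln _ - _ => e0 e1; rewrite ler0_norm//.
  have : d / (x + a) <= d / a.
    by rewrite ler_pM2l// lef_pV2 ?posrE//; lra.
  have : 0 < d * (x + b)^-1 by rewrite divr_gt0//; lra.
  by move: e1; lra.
elim: k => [|k [IH1 IH2]].
  rewrite big_ord0 mul0r addr0 divff ?ln1 ?subrr//.
  by rewrite gt_eqF//; lra.
rewrite /= big_ord_recr /=.
set y := x + (a + k%:R * d) in IH1 IH2 *.
have y0 : 0 < y by exact: pos.
have yS : x + (a + k.+1%:R * d) = y + d by rewrite -natr1 /y; ring.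
rewrite yS.
have yd0 : 0 < y + d by lra.
have xa0 : 0 < x + a by lra.
have -> : ln ((y + d) / (x + a)) = ln (y / (x + a)) + ln (1 + d / y).
  rewrite -lnM ?posrE ?divr_gt0//; last by rewrite addr_gt0// divr_gt0.
  congr ln; field; apply/andP; split; exact: lt0r_neq0.
have u1 : ln (1 + d / y) <= d / y.
  by apply: le_ln1Dx; rewrite (lt_trans (ltrN10 _))// divr_gt0.
have u2 : d / (y + d) <= ln (1 + d / y).
  have -> : 1 + d / y = (1 + - (d / (y + d)))^-1.
    by field; rewrite ?gt_eqF//=; lra.
  have dy1 : d / (y + d) < 1 by rewrite ltr_pdivrMr// mul1r; lra.
  rewrite lnV ?posrE; last by lra.
  by rewrite lerNr; apply: le_ln1Dx; lra.
move: IH1 IH2; set S := \sum_(i < k) _; set l1 := ln (y / _).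
by move: u1 u2; set l2 := ln (1 + _); lra.
Qed.

Lemma completely_monotone_ln_ratio (h a b : R) : 0 < h -> 0 < a -> a < b ->
  completely_monotone (fun n => ln ((n%:R * h + b) / (n%:R * h + a))).
Proof.
move=> h0 a0 ab.
pose d (m : nat) : R := (b - a) / m.+1%:R.
apply: (@completely_monotone_lim
  (fun m n => \sum_(i < m.+1) d m * (n%:R * h + (a + i%:R * d m))^-1)).
  move=> m; have d0 : 0 < d m by rewrite divr_gt0 // subr_gt0.
  apply: (@completely_monotone_sum m.+1
    (fun i n => d m * (n%:R * h + (a + i%:R * d m))^-1)) => i.
  apply: completely_monotoneZ; first exact: ltW.
  by apply: completely_monotone_inv => //; rewrite ltr_pwDl// mulr_ge0// ltW.
move=> n.
have d_cvg : (fun m => d m / a) @ \oo --> 0.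
  rewrite [X in _ --> X](_ : 0 = (b - a) * 0 / a); last by rewrite mulr0 mul0r.
  by apply: cvgMl; apply: cvgMr; exact: cvg_harmonic.
apply/cvgrPdist_le => e e0.
move/cvgrPdist_le : d_cvg => /(_ e e0); apply: filterS => m.
rewrite sub0r normrN => dme; apply: le_trans (ln_ratio_riemann m _ a0 ab) _; first by rewrite mulr_ge0// ltW.
by rewrite (le_trans (ler_norm _)).
Qed.

End completely_monotone.

(** * Discrete Bernstein measures and their moments *)

Section hausdorff.
Context {R : realType}.
Implicit Types (a w phi : nat -> R) (k n N : nat).

(** With [E] the shift operator, [fdiff] is [1 - E], and this is the binomial expansion of
    [((1 - E) + E)^N = 1]. *)
Lemma sum_bin_fdiff a N n :
  \sum_(j < N.+1) 'C(N, j)%:R * iter (N - j) fdiff a (n + j)%N = a n.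
Proof.
elim: N n => [|N IH] n; first by rewrite big_ord_recl big_ord0 bin0 mul1r addn0 addr0.
rewrite big_ord_recl bin0 mul1r addn0 subn0.
under eq_bigr => i _.
  rewrite lift0 subSS binS natrD mulrDl.
  over.
rewrite big_split /= [in X in _ + (X + _)]big_ord_recr /= bin_small// mul0r addr0.
rewrite -[RHS](subrKC (a n.+1)) addrC -[a n - _]/(fdiff a n).
have -> : fdiff a n = \sum_(j < N.+1) 'C(N, j)%:R * (iter (N - j) fdiff a (n + j)%N - iter (N - j) fdiff a (n.+1 + j)%N).
  rewrite -[fdiff a n]/(a n - a n.+1) -{1}(IH n) -(IH n.+1) -sumrB.
  by apply: eq_bigr => j _; rewrite mulrBr.
have -> : \sum_(i < N.+1) 'C(N, i)%:R * iter (N - i) fdiff a (n + i.+1)%N = a n.+1.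
  by rewrite -(IH n.+1); apply: eq_bigr => i _; rewrite addnS addSn.
rewrite [in RHS]big_ord_recl bin0 mul1r addn0 subn0 /= addn0.
rewrite -addrA addrC -addrA; congr (_ + (_ + _)).
apply: eq_bigr => i _; congr (_ * _); rewrite /bump leq0n add1n.
have -> : (N - i = (N - i.+1).+1)%N by have := ltn_ord i; lia.
by [].
Qed.

(** If [a] were the moments of a law on [0, 1], this would be the integral of the Bernstein
    polynomial [C(N,k) x^k (1 - x)^(N - k)]. It serves as the mass placed at [k / N]. *)
Definition bernstein_weight a N k := 'C(N, k)%:R * iter (N - k) fdiff a k.

(** Moments become exact when [(k/N)^n] is replaced by a ratio of binomials: by
    [C(N,k) C(k,n) = C(N,n) C(N-n,k-n)] the sum collapses to [sum_bin_fdiff] at order [N - n]. *)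
Lemma bernstein_weight_moment a N n : (n <= N)%N ->
  \sum_(k < N.+1) bernstein_weight a N k * ('C(k, n)%:R / 'C(N, n)%:R) = a n.
Proof.
move=> nN; rewrite -[RHS](sum_bin_fdiff a (N - n) n).
have -> : N.+1 = (n + (N - n).+1)%N by lia.
rewrite big_split_ord /= big1 ?add0r; last first.
  by move=> i _; rewrite bin_small ?mul0r ?mulr0//.
apply: eq_bigr => i _; rewrite /bernstein_weight.
have iN : (n + i <= N)%N by have := ltn_ord i; lia.
have -> : (N - (n + i) = N - n - i)%N by lia.
rewrite mulrAC; congr (_ * _).
have C0 : 'C(N, n)%:R != 0 :> R by rewrite pnatr_eq0 -lt0n bin_gt0.
apply: (mulIf C0); rewrite -!mulrA mulVf // mulr1 -!natrM; congr (_%:R).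
(* C(N,n+i) C(n+i,n) = C(N-n,i) C(N,n) *)
apply/eqP; rewrite -(@eqn_pmul2r (n`! * (i`! * (N - (n + i))`!))); last by rewrite !muln_gt0 !fact_gt0.
have f1 := bin_fact iN.
have f2 := @bin_fact (n + i) n (leq_addr _ _).
have f3 := bin_fact nN.
have f4 := @bin_fact (N - n) i ltac:(lia).
rewrite addKn in f2.
have e4 : (N - n - i = N - (n + i))%N by lia.
rewrite e4 in f4.
apply/eqP.
transitivity ('C(N, n + i) * (('C(n + i, n) * (n`! * i`!)) * (N - (n + i))`!))%N; first by ring.
by rewrite f2 f1 -f3 -f4; ring.
Qed.

(** The ratio is the product over [m < n] of [(k - m) / (N - m)]. Each factor is within
    [n / (N - n)] of [k / N], and as everything lies in [0, 1] the [n] errors merely add up. *)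
Lemma bin_ratio_close N k n : (k <= N)%N -> (n < N)%N ->
  `| 'C(k, n)%:R / 'C(N, n)%:R - (k%:R / N%:R) ^+ n | <= n%:R * (n%:R / (N - n)%:R) :> R.
Proof.
move=> kN nN.
suff : forall m, (m <= n)%N -> [/\ 0 <= 'C(k, m)%:R / 'C(N, m)%:R :> R, 'C(k, m)%:R / 'C(N, m)%:R <= 1 :> R &
   `| 'C(k, m)%:R / 'C(N, m)%:R - (k%:R / N%:R) ^+ m | <= m%:R * (n%:R / (N - n)%:R) :> R].
  by move=> /(_ n (leqnn n))[].
have r01 : 0 <= (k%:R / N%:R : R) <= 1.
  by rewrite divr_ge0//= ler_pdivrMr ?mul1r ?ler_nat// ltr0n; lia.
elim=> [_|m IH mn].
  by rewrite !bin0 divr1 expr0 subrr normr0 mul0r lexx ler01.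
have [u0 u1 du] := IH (ltnW mn).
pose v : R := (k - m)%:R / (N - m)%:R.
have uS : 'C(k, m.+1)%:R / 'C(N, m.+1)%:R = 'C(k, m)%:R / 'C(N, m)%:R * v :> R.
  rewrite /v.
  have e1 : (m.+1%:R * 'C(k, m.+1)%:R = (k - m)%:R * 'C(k, m)%:R :> R) by rewrite -!natrM mul_bin_left.
  have e2 : (m.+1%:R * 'C(N, m.+1)%:R = (N - m)%:R * 'C(N, m)%:R :> R) by rewrite -!natrM mul_bin_left.
  have n1 : 'C(N, m.+1)%:R != 0 :> R by rewrite pnatr_eq0 -lt0n bin_gt0; lia.
  have n2 : 'C(N, m)%:R != 0 :> R by rewrite pnatr_eq0 -lt0n bin_gt0; lia.
  have n3 : (N - m)%:R != 0 :> R by rewrite pnatr_eq0; lia.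
  have n4 : m.+1%:R != 0 :> R by rewrite pnatr_eq0.
  rewrite mulf_div; apply/eqP; rewrite eqr_div ?mulf_neq0//.
  apply/eqP; apply: (mulfI n4).
  transitivity ((m.+1%:R * 'C(k, m.+1)%:R) * ('C(N, m)%:R * (N - m)%:R) : R); first by ring.
  rewrite e1.
  transitivity (('C(k, m)%:R * (k - m)%:R) * (m.+1%:R * 'C(N, m.+1)%:R) : R); last by ring.
  by rewrite e2; ring.
have v01 : 0 <= v <= 1.
  by rewrite /v divr_ge0//= ler_pdivrMr ?mul1r ?ler_nat ?ltr0n; lia.
have dv : `|v - k%:R / N%:R| <= n%:R / (N - n)%:R.
  have Nn0 : 0 < (N - n)%:R :> R by rewrite ltr0n; lia.
  (* For [k <= m] the truncated subtraction makes the factor [v] zero, and [k / N] itself must be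
     small. *)
  have [km|mk] := leqP k m.
    have kn : (k * (N - n) <= n * N)%N by clear -km mn nN; apply: leq_mul; lia.
    rewrite /v (_ : (k - m)%N = 0%N) ?mul0r ?sub0r ?normrN ?ger0_norm; [|by case/andP: r01|lia].
    rewrite ler_pdivrMr ?ltr0n; last by lia.
    by rewrite mulrAC ler_pdivlMr// -!natrM ler_nat.
  have Nm0 : 0 < (N - m)%:R :> R by rewrite ltr0n; lia.
  have N0 : 0 < N%:R :> R by rewrite ltr0n; lia.
  have -> : v - k%:R / N%:R = - ((m * (N - k))%:R / ((N - m) * N)%:R).
    have mN : (m <= N)%N by clear -mk kN; lia.
    rewrite /v !natrM !natrB//; last exact: ltnW.
    rewrite natrB// in Nm0.
    by field; rewrite !gt_eqF.
  rewrite normrN ger0_norm; last by rewrite divr_ge0.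
  rewrite ler_pdivrMr; last by rewrite natrM mulr_gt0.
  rewrite mulrAC ler_pdivlMr// -!natrM ler_nat.
  clear -mk mn nN kN; rewrite -mulnA; apply: leq_mul; first exact: ltnW.
  by apply: leq_mul; lia.
rewrite uS; move: v01 => /andP[v0 v1]; move: r01 => /andP[r0 r1]; split.
- by rewrite mulr_ge0.
- by rewrite mulr_ile1.
set u := 'C(k, m)%:R / _ in u0 u1 du *; set r := k%:R / N%:R in r0 r1 dv du *.
have -> : u * v - r ^+ m.+1 = (u - r ^+ m) * r + u * (v - r) by rewrite exprSr; ring.
apply: le_trans (ler_normD _ _) _; rewrite -natr1 [leRHS]mulrDl mul1r; apply: lerD.
  by rewrite normrM; apply: le_trans du; rewrite ler_piMr// ger0_norm.
by rewrite normrM; apply: le_trans dv; rewrite ler_piMl// ger0_norm.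
Qed.

Lemma bernstein_moment_cvg a n : completely_monotone a -> a 0%N = 1 ->
  (fun N => \sum_(k < N.+2) bernstein_weight a N.+1 k * (k%:R / N.+1%:R) ^+ n)
    @ \oo --> a n.
Proof.
move=> ha a0.
have w0 N k : 0 <= bernstein_weight a N k by rewrite mulr_ge0.
have w1 N : \sum_(k < N.+1) bernstein_weight a N k = 1.
  rewrite -a0 -[RHS](@bernstein_weight_moment a N 0%N)//.
  by apply: eq_bigr => i _; rewrite !bin0 divr1 mulr1.
have bnd : (fun N : nat => n%:R * (n%:R * (N.+1%:R : R)^-1)) @ \oo --> (0 : R).
  rewrite [X in _ --> X](_ : 0 = n%:R * (n%:R * 0)); last by rewrite !mulr0.
  by apply: cvgMr; apply: cvgMr; exact: cvg_harmonic.
apply/cvgrPdist_le => e e0.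
move/cvgrPdist_le : bnd => /(_ e e0) [M _ HM].
(* The error at size [N.+1] is governed by [1 / (N.+1 - n)], the harmonic term of index [N - n];
   hence the threshold is shifted by [n]. *)
exists (M + n)%N => // N /= MN.
have nN : (n < N.+1)%N by lia.
rewrite -(@bernstein_weight_moment a N.+1 n (ltnW nN)) -sumrB.
apply: le_trans (ler_norm_sum _ _ _) _.
have HM' := HM (N - n)%N ltac:(rewrite /=; lia).
rewrite sub0r normrN in HM'.
rewrite -[leRHS]mul1r -[X in X * e](w1 N.+1) mulr_suml; apply: ler_sum => k _.
rewrite -mulrBr normrM ger0_norm//; apply: ler_wpM2l => //.
apply: le_trans (bin_ratio_close _ nN) _; first by have := ltn_ord k; lia.
rewrite subSn; last lia.
by apply: le_trans HM'; exact: ler_norm.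
Qed.

(* [S] is a discrete cumulative distribution function and [count_below S N]
   its quantile function. *)
Definition count_below (S : nat -> R) N (u : R) : nat :=
  \sum_(k < N) (S k < u)%R.

(** As [S] is nondecreasing, the indices with [S k < u] form an initial segment, over which the
    increments of [phi] telescope. *)
Lemma count_below_telescope S N u phi :
  {homo S : k l / (k <= l)%N >-> k <= l} ->
  phi (count_below S N u) =
  phi 0%N + \sum_(k < N) (S k < u)%R%:R * (phi k.+1 - phi k).
Proof.
move=> ndS; elim: N => [|N IH]; first by rewrite /count_below !big_ord0 addr0.
rewrite /count_below !big_ord_recr /= -/(count_below S N u).
have [SNu|] := boolP (S N < u); last by rewrite mul0r addn0 addr0 IH.
rewrite mul1r addrA -IH.
suff -> : count_below S N u = N by rewrite addn1 subrKC.
rewrite /count_below (eq_bigr (fun=> 1%N)) ?sum1_card ?card_ord// => i _.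
by rewrite (le_lt_trans _ SNu)// ndS// ltnW.
Qed.

Lemma abel_summation w phi S N : (forall k, S k = \sum_(j < k.+1) w j) ->
  phi 0%N * S N + \sum_(k < N) (S N - S k) * (phi k.+1 - phi k) =
  \sum_(k < N.+1) w k * phi k.
Proof.
move=> SE; elim: N => [|N IH].
  by rewrite SE big_ord0 !big_ord_recr !big_ord0 /= !add0r addr0 mulrC.
rewrite [RHS]big_ord_recr -IH /=.
have SS : S N.+1 = S N + w N.+1 by rewrite !SE big_ord_recr.
rewrite big_ord_recr SS /=.
have -> : \sum_(i < N) (S N + w N.+1 - S i) * (phi i.+1 - phi i) =
  \sum_(i < N) (S N - S i) * (phi i.+1 - phi i) + w N.+1 * (phi N - phi 0%N).
  rewrite -(telescope_sumr phi (leq0n N)) big_mkord mulr_sumr -big_split /=.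
  by apply: eq_bigr => i _; ring.
by ring.
Qed.

End hausdorff.

(** * Hausdorff's moment theorem in quantile form *)

Section hausdorff_integral.
Context {R : realType}.
Notation mu := (@lebesgue_measure R).

Lemma bounded_integrable d (T : measurableType d) (m : {measure set T -> \bar R})
    (D : set T) (g : T -> R) (K : R) :
  measurable D -> (m D < +oo)%E -> measurable_fun D g ->
  (forall x, D x -> `|g x| <= K) -> m.-integrable D (EFin \o g).
Proof.
move=> mD Dfin mg gK; apply: measurable_bounded_integrable => //.
exists K; split; first exact: num_real.
by move=> x Kx y Dy; apply: le_trans (gK _ Dy) (ltW Kx).
Qed.

Lemma itv_bounded_integrable (a b : R) (s t : bool) (g : R -> R) (K : R) :
  measurable_fun setT g -> (forall x, `|g x| <= K) ->
  mu.-integrable [set` Interval (BSide s a) (BSide t b)] (EFin \o g).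
Proof.
move=> mg gK; apply: (@bounded_integrable _ _ _ _ _ K) => //.
- by rewrite /= lebesgue_measure_itv /=; case: ifPn => // _; rewrite -EFinB ltry.
- exact: measurable_funTS.
Qed.

Lemma integrable_Rsum d (T : measurableType d) (m : {measure set T -> \bar R})
    (D : set T) (n : nat) (F : nat -> T -> R) : measurable D ->
  (forall k, m.-integrable D (EFin \o F k)) ->
  m.-integrable D (EFin \o (fun x => \sum_(k < n) F k x)).
Proof.
move=> mD iF.
rewrite (_ : EFin \o _ = fun x => (\sum_(k < n) (F k x)%:E)%E).
  by apply: integrable_sum => // k _; exact: iF.
by apply/funext => x; rewrite /= sumEFin.
Qed.

Lemma Rintegral_sum d (T : measurableType d) (m : {measure set T -> \bar R})
    (D : set T) (n : nat) (F : nat -> T -> R) : measurable D ->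
  (forall k, m.-integrable D (EFin \o F k)) ->
  \int[m]_(x in D) (\sum_(k < n) F k x) = \sum_(k < n) \int[m]_(x in D) F k x.
Proof.
move=> mD iF; elim: n => [|n IH].
  under eq_Rintegral do rewrite big_ord0.
  by rewrite Rintegral_cst// mul0r big_ord0.
under eq_Rintegral do rewrite big_ord_recr /=.
by rewrite RintegralD ?IH ?big_ord_recr//; exact: integrable_Rsum.
Qed.

Lemma Rintegral_cst_itvoc (a b c : R) : a <= b ->
  \int[mu]_(x in `]a, b]) c = c * (b - a).
Proof.
move=> ab; rewrite Rintegral_cst//= lebesgue_measure_itv /= lte_fin.
case: ltP => [//|ba].
by rewrite (@le_anti _ _ a b) ?ab// subrr.
Qed.

(** On each cell the integral lies between the two endpoint values, so the total error telescopes to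
    at most [(g 1 - g 0) / M.+1]. That the bound is independent of [g] is what later allows a limit
    in [g] at fixed [M]. *)
Lemma riemann_sum_nondecreasing (g : R -> R) (M : nat) :
  {homo g : x y / x <= y} -> (forall x, 0 <= g x <= 1) ->
  `| \int[mu]_(x in `[0, 1]) g x -
     M.+1%:R^-1 * \sum_(i < M.+1) g (i%:R * M.+1%:R^-1) | <= M.+1%:R^-1.
Proof.
move=> ndg g01.
set h : R := M.+1%:R^-1.
have h0 : 0 < h by rewrite invr_gt0.
have mg : measurable_fun setT g by exact: nondecreasing_measurable.
have gK x : `|g x| <= 1 by have /andP[? ?] := g01 x; rewrite ger0_norm.
have ig (a b : R) (s t : bool) : mu.-integrable [set` Interval (BSide s a) (BSide t b)] (EFin \o g).
  exact: itv_bounded_integrable gK.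
have ic (a b c : R) (s t : bool) : mu.-integrable [set` Interval (BSide s a) (BSide t b)] (EFin \o cst c).
  exact: (@itv_bounded_integrable _ _ _ _ _ `|c|).
have step k : g (k%:R * h) * h <= \int[mu]_(x in `]k%:R * h, k.+1%:R * h]) g x <= g (k.+1%:R * h) * h.
  have kk : k%:R * h <= k.+1%:R * h by rewrite ler_pM2r// ler_nat.
  have E (c : R) : c * h = \int[mu]_(x in `]k%:R * h, k.+1%:R * h]) c.
    by rewrite Rintegral_cst_itvoc// -mulrBl -natr1 addrAC subrr add0r mul1r.
  rewrite (E (g (k%:R * h))) (E (g (k.+1%:R * h))).
  apply/andP; split; apply: le_Rintegral => //; do ?exact: ig; do ?exact: (ic _ _ _ false false).
    by move=> x /=; rewrite in_itv/= => /andP[/ltW kx _]; exact: ndg.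
  by move=> x /=; rewrite in_itv/= => /andP[_ kx]; exact: ndg.
have bnd k : h * \sum_(i < k) g (i%:R * h) <= \int[mu]_(x in `]0, k%:R * h]) g x
            <= h * \sum_(i < k) g (i%:R * h) + h * (g (k%:R * h) - g 0).
  elim: k => [|k /andP[IH1 IH2]].
    by rewrite big_ord0 mul0r mulr0 add0r set_itvoc0 Rintegral_set0 subrr mulr0 lexx.
  have E : \int[mu]_(x in `]0, k.+1%:R * h]) g x =
     \int[mu]_(x in `]0, k%:R * h]) g x + \int[mu]_(x in `]k%:R * h, k.+1%:R * h]) g x.
    rewrite -(@Rintegral_itvB _ g (BRight 0) (BRight (k.+1%:R * h)) (k%:R * h)).
    - by rewrite subrKC.
    - exact: ig.
    - by rewrite bnd_simp mulr_ge0// ltW.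
    - by rewrite bnd_simp ler_pM2r// ler_nat.
  rewrite E big_ord_recr/= mulrDr.
  have /andP[s1 s2] := step k; move: s1 s2 IH1 IH2.
  move: (\int[mu]_(x in `]0, k%:R * h]) g x) => I1.
  move: (\int[mu]_(x in `]k%:R * h, k.+1%:R * h]) g x) => I2.
  by clear => *; apply/andP; split; lra.
have /andP[b1 b2] := bnd M.+1.
have M1 : M.+1%:R * h = 1 by rewrite /h divff// pnatr_eq0.
rewrite M1 in b1 b2.
rewrite -Rintegral_itv_obnd_cbnd; last exact: ig.
have : h * (g 1 - g 0) <= h.
  rewrite -[leRHS]mulr1 ler_pM2l//.
  by have /andP[_ ?] := g01 1; have /andP[? _] := g01 0; lra.
rewrite ger0_norm; last by rewrite subr_ge0.
move: b1 b2; move: (\int[mu]_(x in `]0, 1]) g x) => I1.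
by clear => *; lra.
Qed.

Lemma Rintegral_indic_gt (s : R) : 0 <= s <= 1 ->
  \int[mu]_(u in `[0, 1]) ((s < u)%R%:R : R) = 1 - s.
Proof.
move=> /andP[s0 s1].
transitivity (\int[mu]_(u in `[0, 1]) ((cst (1 : R)) \_ `]s, 1]) u).
  apply: eq_Rintegral => u; rewrite inE/= in_itv/= => /andP[u0 u1].
  rewrite patchE; case: ifPn.
    by rewrite inE /= in_itv /= u1 andbT => ->.
  by rewrite notin_setE /= in_itv /= u1 andbT => /negP/negbTE ->.
rewrite -Rintegral_mkcondr setIidr; last first.
  by move=> x /=; rewrite !in_itv/= => /andP[sx ->]; rewrite andbT (le_trans s0)// ltW.
by rewrite Rintegral_cst_itvoc// mul1r.
Qed.

(** The quantile function transports the uniform law to the discrete law [w]: integrating the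
    telescoped form of [phi] term by term gives one side of Abel's summation. *)
Lemma Rintegral_count_below (w phi : nat -> R) (N : nat) :
  (forall k, 0 <= w k) -> \sum_(k < N.+1) w k = 1 ->
  \int[mu]_(u in `[0, 1]) phi (count_below (fun k => \sum_(j < k.+1) w j) N u) =
  \sum_(k < N.+1) w k * phi k.
Proof.
move=> w0 w1; pose S k := \sum_(j < k.+1) w j.
rewrite -/S.
have ndS : {homo S : k l / (k <= l)%N >-> k <= l}.
  apply: homo_leq => [//|x y z xy yz|k]; first exact: le_trans xy yz.
  by rewrite /S [leRHS]big_ord_recr /= lerDl.
have SN : S N = 1 by [].
have S0 k : 0 <= S k by exact: sumr_ge0.
rewrite -(@abel_summation _ w phi S N)// SN mulr1.
transitivity (\int[mu]_(u in `[0, 1])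
  (phi 0%N + \sum_(k < N) (S k < u)%R%:R * (phi k.+1 - phi k))).
  by apply: eq_Rintegral => u _; exact: count_below_telescope.
have mS k : measurable_fun setT (fun u => ((S k < u)%R%:R : R)).
  by apply: nondecreasing_measurable => // x y xy; rewrite ler_nat; case: ltP => // Sx; rewrite (lt_le_trans Sx xy).
have iS k (c : R) : mu.-integrable `[0, 1] (EFin \o (fun u => (S k < u)%R%:R * c)).
  apply: (@itv_bounded_integrable _ _ _ _ _ `|c|); first exact: measurable_funM.
  by move=> x; rewrite normrM ler_piMl// normr_nat lern1 leq_b1.
rewrite RintegralD//; last 2 first.
- exact: (@itv_bounded_integrable _ _ _ _ (cst (phi 0%N)) `|phi 0%N|).
- exact: (@integrable_Rsum _ (measurableTypeR R) mu _ N (fun k (u : R) => (S k < u)%R%:R * (phi k.+1 - phi k))).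
rewrite Rintegral_cst//= lebesgue_measure_itv /= lte_fin ltr01 /= subr0 mulr1.
congr (_ + _).
rewrite (@Rintegral_sum _ (measurableTypeR R) mu _ N (fun k (u : R) => (S k < u)%R%:R * (phi k.+1 - phi k)))//.
apply: eq_bigr => k _; rewrite RintegralZr//.
  by rewrite Rintegral_indic_gt// S0 -SN ndS// ltnW.
apply: (@itv_bounded_integrable _ _ _ _ _ 1) => // x.
by rewrite normr_nat lern1 leq_b1.
Qed.

(** Compactness provides a cluster point, and an ultrafilter converges to any of its cluster points:
    were a neighbourhood not in it, the complement would be, and it would have to meet that
    neighbourhood. *)
Lemma ultra_cvg_segment (T : Type) (U : set_system T) (f : T -> R) (a b : R) :
  UltraFilter U -> (forall x, a <= f x <= b) ->
  exists2 q, a <= q <= b & f @ U --> q.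
Proof.
move=> UU fab.
have [|q [/= qab clq]] := @segment_compact R a b (f @ U) _.
  by apply: (@filterE _ U) => x /=; rewrite in_itv/= fab.
exists q; first by move: qab; rewrite in_itv.
move=> A Aq; have [//|UnA] := @in_ultra_setVsetC _ U (f @^-1` A) UU.
by have [y [? ?]] := clq (~` A) A UnA Aq.
Qed.

(* The quantile functions of the discrete Bernstein measures converge pointwise
   along an ultrafilter, and for monotone functions Riemann sums approximate the
   integral uniformly, so that moments pass to the limit. *)
Theorem hausdorff_quantile (a : nat -> R) : completely_monotone a -> a 0%N = 1 ->
  exists Q : R -> R, [/\ {homo Q : x y / x <= y}, forall x, 0 <= Q x <= 1 &
    forall n, \int[mu]_(u in `[0, 1]) (Q u ^+ n) = a n].
Proof.
move=> ha a0.
have w0 N k : 0 <= bernstein_weight a N k by rewrite mulr_ge0.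
have w1 N : \sum_(k < N.+1) bernstein_weight a N k = 1.
  rewrite -a0 -[RHS](@bernstein_weight_moment _ a N 0%N)//.
  by apply: eq_bigr => i _; rewrite !bin0 divr1 mulr1.
pose q N u : R :=
  (count_below (fun k => \sum_(j < k.+1) bernstein_weight a N.+1 j) N.+1 u)%:R / N.+1%:R.
have q01 N u : 0 <= q N u <= 1.
  rewrite divr_ge0//= ler_pdivrMr// mul1r ler_nat.
  rewrite /count_below -[leqRHS]card_ord -sum1_card; apply: leq_sum => i _.
  exact: leq_b1.
have ndq N : {homo q N : x y / x <= y}.
  move=> x y xy; rewrite ler_pM2r ?invr_gt0// ler_nat; apply: leq_sum => i _.
  by case: ltP => // /lt_le_trans -> //.
(* One ultrafilter finer than the filter of large indices serves all [u] simultaneously, in place of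
   a diagonal extraction of subsequences. *)
have [U [UU ooU]] := ultraFilterLemma eventually_filter.
have /choice [Q HQ] : forall u, exists v : R, 0 <= v <= 1 /\ q ^~ u @ U --> v.
  by move=> u; have [v ? ?] := @ultra_cvg_segment _ U (q ^~ u) 0 1 UU (q01^~ u); exists v.
have Q01 x : 0 <= Q x <= 1 by have [] := HQ x.
have ndQ : {homo Q : x y / x <= y}.
  move=> x y xy; have [_ qx] := HQ x; have [_ qy] := HQ y.
  by apply: ler_cvg_to qx qy _; apply: filterE => N; exact: ndq.
exists Q; split=> // n.
have pow (g : R -> R) : {homo g : x y / x <= y} -> (forall x, 0 <= g x <= 1) ->
  {homo (fun x => g x ^+ n) : x y / x <= y} /\ forall x, 0 <= g x ^+ n <= 1.
  move=> ndg g01; split=> [x y xy|x].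
    have /andP[gx _] := g01 x; have /andP[gy _] := g01 y.
    by rewrite lerXn2r ?nnegrE// ndg.
  by have /andP[gx g1] := g01 x; rewrite exprn_ge0//= exprn_ile1.
have mom : (fun N => \int[mu]_(u in `[0, 1]) (q N u ^+ n)) @ U --> a n.
  have := @bernstein_moment_cvg _ a n ha a0.
  under [in X in X -> _]eq_fun => N.
    rewrite -(@Rintegral_count_below (bernstein_weight a N.+1) (fun k => (k%:R / N.+1%:R) ^+ n) N.+1 (w0 _) (w1 _)).
    over.
  move=> h A /h hA; exact: ooU.
(* At fixed [M] the Riemann sum involves finitely many points, so pointwise convergence is enough to
   take the limit in [N]; the bound survives because it is uniform in [N]. *)
have near_a (M : nat) : `|a n - M.+1%:R^-1 * \sum_(i < M.+1) Q (i%:R * M.+1%:R^-1) ^+ n| <= M.+1%:R^-1.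
  set h : R := M.+1%:R^-1.
  have c1 : (fun N => h * \sum_(i < M.+1) q N (i%:R * h) ^+ n) @ U -->
     h * \sum_(i < M.+1) Q (i%:R * h) ^+ n.
    clearbody h.
    apply: cvgMr.
    elim: M.+1 => [|k IH].
      rewrite big_ord0; under eq_fun do rewrite big_ord0.
      exact: cvg_cst.
    rewrite big_ord_recr; under eq_fun do rewrite big_ord_recr /=.
    apply: cvgD => //.
    have [_ qk] := HQ (k%:R * h).
    exact: (continuous_cvg _ (@exprn_continuous _ n _) qk).
  have FU : Filter U by exact: filter_filter.
  apply: ler_cvg_to (cvg_norm (cvgB mom c1)) (@cvg_cst _ h _ U FU) _.
  apply: filterE => N /=.
  have [p1 p2] := pow _ (ndq N) (q01 N).
  exact: riemann_sum_nondecreasing p1 p2.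
apply/eqP; rewrite -subr_eq0 -normr_le0; apply/ler_addgt0Pr => e e0; rewrite add0r.
have e20 : 0 < e / 2 by rewrite divr_gt0.
have /cvgrPdist_le/(_ _ e20) [M _ /(_ M (leqnn _))] := @cvg_harmonic R.
rewrite /= sub0r normrN ger0_norm ?invr_ge0// => Me.
have [p1 p2] := pow _ ndQ Q01.
have := riemann_sum_nondecreasing M p1 p2; have := near_a M.
set X := _ * \sum_(i < _) _; rewrite !ler_norml => /andP[h1 h2] /andP[h3 h4].
have lin (I A Y h e' : R) : h <= e' / 2 -> - h <= A - Y -> A - Y <= h ->
  - h <= I - Y -> I - Y <= h -> - e' <= I - A <= e'.
  by clear => *; apply/andP; split; lra.
exact: lin Me h1 h2 h3 h4.
Qed.

End hausdorff_integral.

(** * Determinacy of moment problems with geometrically bounded moments *)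

Section determinacy.
Context {R : realType}.

(** Bernoulli's inequality in reciprocal form, effective when [n * y] is large; the lower bound that
    follows is effective when [n * y] is small. *)
Lemma onem_expn_le (y : R) n : 0 <= y <= 1 -> (1 - y) ^+ n <= (1 + n%:R * y)^-1.
Proof.
move=> /andP[y0 y1]; elim: n => [|n IH]; first by rewrite mul0r addr0 invr1 expr0.
have n0 : 0 <= n%:R * y by rewrite mulr_ge0.
rewrite exprS; apply: le_trans (ler_wpM2l _ IH) _; first by lra.
rewrite ler_pdivrMr; last by lra.
rewrite mulrC ler_pdivlMr -?natr1; last by lra.
by nra.
Qed.

Lemma onem_expn_ge (y : R) n : 0 <= y <= 1 -> 1 - n%:R * y <= (1 - y) ^+ n.
Proof.
move=> /andP[y0 y1]; elim: n => [|n IH]; first by rewrite mul0r subr0 expr0.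
have n0 : 0 <= n%:R * y by rewrite mulr_ge0.
rewrite exprSr; apply: le_trans (ler_wpM2r _ IH); last by lra.
rewrite -natr1; nra.
Qed.

Definition cutoff_exponent (th : R) (n : nat) : nat :=
  Num.trunc (th ^- n.+1 / n.+1%:R).

(* The exponent is chosen so that [cutoff_exponent th n * t ^+ n.+1] tends to 0
   for [t <= th] (including [t = th]) and to infinity for [t > th]. *)
Lemma cutoff_cvg (th t : R) : 0 < th < 1 -> 0 <= t <= 1 ->
  (fun n => (1 - t ^+ n.+1) ^+ (cutoff_exponent th n)) @ \oo --> ((t <= th)%R%:R : R).
Proof.
move=> /andP[th0 th1] /andP[t0 t1].
have tn n : 0 <= t ^+ n.+1 <= 1 by rewrite exprn_ge0//= exprn_ile1.
have thn n : 0 < th ^+ n by rewrite exprn_gt0.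
have a0 n : 0 <= th ^- n.+1 / n.+1%:R by rewrite divr_ge0// invr_ge0 ltW.
have [tth|tht] := leP t th.
  have sandwich : (fun n : nat => 1 - n.+1%:R^-1 : R) @ \oo --> (1 : R).
    rewrite [X in _ --> X](_ : 1 = 1 - 0); last by rewrite subr0.
    by apply: cvgB; [exact: cvg_cst|exact: cvg_harmonic].
  apply: (@squeeze_cvgr _ _ _ _ (fun n : nat => 1 - n.+1%:R^-1 : R) (fun=> 1)) => //;
    last exact: cvg_cst.
  apply: nearW => n; have /andP[tn0 tn1] := tn n; apply/andP; split; last first.
    by rewrite exprn_ile1; lra.
  apply: le_trans (onem_expn_ge _ (tn n)); rewrite lerD2l lerN2.
  have /truncn_itv/andP[aa _] := a0 n.
  apply: (@le_trans _ _ (th ^- n.+1 / n.+1%:R * th ^+ n.+1)).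
    by apply: ler_pM => //; rewrite lerXn2r ?nnegrE// ltW.
  by rewrite mulrAC mulVf ?mul1r// gt_eqF.
pose r := t / th.
have r1 : 1 < r by rewrite ltr_pdivlMr// mul1r.
have bnd n : (1 - t ^+ n.+1) ^+ (cutoff_exponent th n) <= (r ^+ n.+1 / n.+1%:R)^-1.
  apply: le_trans (onem_expn_le _ (tn n)) _.
  have rn0 : 0 < r ^+ n.+1 / n.+1%:R by rewrite divr_gt0// exprn_gt0// (lt_trans _ r1).
  have /truncn_itv/andP[_ aa] := a0 n.
  have /andP[tn0 tn1] := tn n.
  have pos : 0 < 1 + (cutoff_exponent th n)%:R * t ^+ n.+1 by rewrite ltr_pwDl// mulr_ge0.
  rewrite lef_pV2 ?posrE//.
  have -> : r ^+ n.+1 / n.+1%:R = th ^- n.+1 / n.+1%:R * t ^+ n.+1.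
    by rewrite /r expr_div_n; ring.
  apply: le_trans (ler_wpM2r tn0 (ltW aa)) _.
  rewrite /cutoff_exponent; set a := Num.trunc _.
  by rewrite -(natr1 a) mulrDl mul1r addrC lerD2r.
(* r^(n+1)/(n+1) >= (n/2) (r-1)^2 *)
pose d := r - 1.
have d0 : 0 < d by rewrite subr_gt0.
have rge n : n%:R * d ^+ 2 / 2 <= r ^+ n.+1 / n.+1%:R.
  rewrite ler_pdivlMr//.
  have -> : r = 1 + d by rewrite /d subrKC.
  elim: n => [|n IH]; first by rewrite !mul0r exprn_ge0//; lra.
  have bern : 1 + n.+1%:R * d <= (1 + d) ^+ n.+1.
    elim: n {IH} => [|n IH]; first by rewrite mul1r expr1.
    rewrite exprSr; apply: le_trans (ler_wpM2r _ IH); last by lra.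
    rewrite -natr1; have : 0 <= n.+1%:R * d by rewrite mulr_ge0// ltW.
    by nra.
  have := ler_wpM2l (ltW d0) bern; rewrite [(1 + d) ^+ n.+2]exprS.
  move: IH; rewrite -(natr1 n.+1) -(natr1 n); move: ((1 + d) ^+ n.+1) => X.
  by clear -d0; move: (n%:R : R) => N; nra.
apply: (@squeeze_cvgr _ _ _ _ (fun=> 0) (fun n : nat => (n%:R * d ^+ 2 / 2)^-1)).
- near=> n; have n0 : (0 < n)%N by near: n; exists 1%N.
  have /andP[tn0 tn1] := tn n.
  rewrite exprn_ge0/=; last by lra.
  apply: le_trans (bnd n) _.
  have p0 : 0 < n%:R * d ^+ 2 / 2 by rewrite divr_gt0// mulr_gt0 ?ltr0n// exprn_gt0.
  by rewrite lef_pV2 ?posrE// (lt_le_trans p0).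
- exact: cvg_cst.
- rewrite -(cvg_shiftS _) /=.
  rewrite (_ : (fun n : nat => _) = fun n : nat => (d ^+ 2 / 2)^-1 * n.+1%:R^-1).
    have c : (fun n : nat => (d ^+ 2 / 2)^-1 * harmonic n) @ \oo --> (d ^+ 2 / 2)^-1 * 0.
      by apply: cvgMr; exact: cvg_harmonic.
    by rewrite mulr0 in c.
  by apply/funext => n; rewrite -mulrA invfM mulrC.
Unshelve. all: by end_near. Qed.

Lemma eq_integral_poly (mu nu : {measure set (measurableTypeR R) -> \bar R})
    (D : set R) (p : {poly R}) : measurable D ->
  (forall n, mu.-integrable D (EFin \o (fun x => x ^+ n))) ->
  (forall n, nu.-integrable D (EFin \o (fun x => x ^+ n))) ->
  (forall n, \int[mu]_(x in D) (x ^+ n) = \int[nu]_(x in D) (x ^+ n)) ->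
  \int[mu]_(x in D) p.[x] = \int[nu]_(x in D) p.[x].
Proof.
move=> mD imu inu e.
have i1 (m : {measure set (measurableTypeR R) -> \bar R}) :
    (forall n, m.-integrable D (EFin \o (fun x => x ^+ n))) ->
    \int[m]_(x in D) p.[x] = \sum_(k < size p) p`_k * \int[m]_(x in D) (x ^+ k).
  move=> im; under eq_Rintegral do rewrite horner_coef.
  rewrite (@Rintegral_sum _ _ (measurableTypeR R) m D (size p) (fun k x => p`_k * x ^+ k))//.
    by apply: eq_bigr => k _; rewrite RintegralZl.
  move=> k; rewrite (_ : EFin \o _ = fun x => ((p`_k)%:E * (x ^+ k)%:E)%E).
    exact: integrableZl (im k).
  by apply/funext => x; rewrite /= EFinM.
by rewrite i1// i1//; apply: eq_bigr => k _; rewrite e.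
Qed.

Section moment_problem.
Variables (mu : {measure set (measurableTypeR R) -> \bar R}) (m : nat -> R) (K : R).
Hypothesis mom : forall n, (\int[mu]_x (x ^+ n)%:E = (m n)%:E)%E.
Hypothesis K0 : 0 <= K.
Hypothesis mK : forall n, m (2 * n)%N <= K ^+ (2 * n).

Lemma moment_total_mass : mu setT = (m 0%N)%:E.
Proof.
by rewrite -mom -[LHS]mul1e -integral_cst.
Qed.

Lemma moment_finite A : measurable A -> (mu A < +oo)%E.
Proof.
move=> mA; apply: (@le_lt_trans _ _ (mu setT)).
  by apply: le_measure; rewrite ?inE.
by rewrite moment_total_mass ltry.
Qed.

(** Markov's inequality for the even power [x^(2n)] bounds this mass by [(K / L)^(2n)], for every
    [n]. *)
Lemma moment_tail (L : R) : K < L -> mu (~` `[- L, L]%classic) = 0%E.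
Proof.
move=> KL; set S := ~` _.
have mS : measurable S by apply: measurableC.
have L0 : 0 < L by exact: le_lt_trans KL.
have Sfin : mu S \is a fin_num by rewrite ge0_fin_numE// moment_finite.
suff : fine (mu S) <= 0.
  move=> s0; apply/eqP; rewrite eq_le measure_ge0 andbT.
  by rewrite -(fineK Sfin) lee_fin.
have bnd n : fine (mu S) <= ((K / L) ^+ 2) ^+ n.
  rewrite -exprM expr_div_n ler_pdivlMr ?exprn_gt0//.
  apply: le_trans (mK n); rewrite -lee_fin EFinM fineK// -mom.
  apply: (@le_trans _ _ (\int[mu]_(x in S) (x ^+ (2 * n))%:E)%E).
    rewrite muleC -integral_cst//; apply: ge0_le_integral => //.
    - by move=> x _; rewrite lee_fin exprn_ge0// ltW.
    - by apply/measurable_EFinP/measurable_funTS; exact: exprn_measurable.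
    - move=> x; rewrite /S /= in_itv/= -ler_norml => /negP; rewrite -ltNge => Lx.
      rewrite lee_fin -[leRHS]ger0_norm; last by rewrite exprM exprn_ge0// sqr_ge0.
      by rewrite normrX lerXn2r ?nnegrE// ltW.
  apply: ge0_subset_integral => //.
  - by apply/measurable_EFinP; exact: exprn_measurable.
  - by move=> x _; rewrite lee_fin exprM exprn_ge0// sqr_ge0.
have r1 : `|(K / L) ^+ 2| < 1.
  by rewrite ger0_norm ?sqr_ge0// expr_lt1 ?ltr_pdivrMr ?mul1r// divr_ge0// ltW.
have c0 := cvg_expr r1.
apply: ler_cvg_to (@cvg_cst _ (fine (mu S)) _ \oo _) c0 _.
by apply: nearW => n; exact: bnd.
Qed.

Lemma moment_integrable (L : R) n : mu.-integrable `[- L, L] (EFin \o (fun x => x ^+ n)).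
Proof.
apply: (@bounded_integrable _ _ _ _ _ _ (L ^+ n)) => //.
- exact: moment_finite.
- move=> x /=; rewrite in_itv/= -ler_norml => xL.
  by rewrite normrX lerXn2r ?nnegrE// (le_trans _ xL).
Qed.

Lemma moment_truncated (L : R) n : K < L -> \int[mu]_(x in `[- L, L]) (x ^+ n) = m n.
Proof.
move=> KL; rewrite /Rintegral.
have mS : measurable (~` `[- L, L]%classic : set R) by apply: measurableC.
have mX : measurable_fun setT (fun x : R => (x ^+ n)%:E).
  by apply/measurable_EFinP; exact: exprn_measurable.
have := mom n; rewrite -(setUv `[- L, L]%classic) integral_setU//=; last 2 first.
  by rewrite setUv.
  exact/disj_setPCl.
rewrite [X in (_ + X)%E]null_set_integral//; last 2 first.
  exact: measurable_funTS.
  exact: moment_tail.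
by rewrite adde0 => ->.
Qed.

End moment_problem.

(** Half-lines []x0, +oo[] generate the Borel sets and are stable under intersection, so it suffices
    to recover their masses from the moments. On a segment carrying all the mass, polynomials with
    values in [0, 1] converge pointwise to the indicator of the half-line. *)
Theorem moment_determinacy (mu nu : {measure set (measurableTypeR R) -> \bar R})
    (m : nat -> R) (K : R) : 0 <= K ->
  (forall n, m (2 * n)%N <= K ^+ (2 * n)) ->
  (forall n, \int[mu]_x (x ^+ n)%:E = (m n)%:E)%E ->
  (forall n, \int[nu]_x (x ^+ n)%:E = (m n)%:E)%E ->
  forall A, measurable A -> mu A = nu A.
Proof.
move=> K0 mK mmu mnu A mA.
apply: (@measure_unique _ R (measurableTypeR R) (@RGenOInfty.G R) (fun k => `](- k%:R)%R, +oo[%classic) _ _ _ _ mu nu) => //.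
- exact: RGenOInfty.measurableE.
- move=> _ _ [x ->] [y ->]; exists (Num.max x y).
  by apply/seteqP; split=> z /=; rewrite !in_itv/= !andbT gt_max => /andP.
- by move=> i; exists (- i%:R).
- apply/seteqP; split=> // x _; exists (Num.trunc `|x|).+1 => //=.
  rewrite in_itv/= andbT ltrNl; apply: le_lt_trans (ler_norm _) _.
  by rewrite normrN; have /truncn_itv/andP[] := normr_ge0 x.
- move=> _ [x0 ->].
  (* [L] exceeds [K], so that no mass lies outside the segment, and exceeds [|x0|], so that the
     image [th] of [x0] under the affine map from [[-L, L]] onto [0, 1] is interior. *)
  pose L : R := Num.max (K + 1) (`|x0| + 1).
  have KL : K < L by rewrite lt_max ltrDl ltr01.
  have xL : `|x0| < L by rewrite lt_max [X in _ || X]ltrDl ltr01 orbT.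
  have L0 : 0 < L by exact: le_lt_trans KL.
  pose th := (x0 + L) / (2 * L).
  have /andP[x1 x2] : - L < x0 < L by rewrite -ltr_norml.
  have th01 : 0 < th < 1.
    by rewrite /th ltr_pdivrMr ?divr_gt0 ?mulr_gt0//; lra.
  (* The powers in [cutoff_cvg] tend to the indicator of [t <= th], whence the complement to 1. *)
  pose p n : {poly R} := 1 - (1 - ((2 * L)^-1 *: ('X + L%:P)) ^+ n.+1) ^+ (cutoff_exponent th n).
  have pE n x : (p n).[x] = 1 - (1 - ((x + L) / (2 * L)) ^+ n.+1) ^+ (cutoff_exponent th n).
    by rewrite /p !(hornerE, horner_exp) mulrC.
  have t01 x : `[- L, L]%classic x -> 0 <= (x + L) / (2 * L) <= 1.
    rewrite /= in_itv/= => /andP[? ?].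
    by rewrite divr_ge0 ?ler_pdivrMr ?mulr_gt0//; lra.
  have main (l : {measure set (measurableTypeR R) -> \bar R}) :
      (forall n, \int[l]_x (x ^+ n)%:E = (m n)%:E)%E ->
      (fun n => \int[l]_(x in `[- L, L]) (p n).[x]) @ \oo --> fine (l `]x0, +oo[%classic).
    move=> ml.
    have lfin := moment_finite ml.
    have ltail := moment_tail ml K0 mK KL.
    have cv x : `[- L, L]%classic x -> (fun n => (p n).[x]) @ \oo --> ((x0 < x)%R%:R : R).
      move=> Lx; under eq_fun do rewrite pE.
      have -> : (x0 < x)%R%:R = 1 - ((x + L) / (2 * L) <= th)%R%:R :> R.
        rewrite /th ler_pM2r ?invr_gt0 ?mulr_gt0// lerD2r.
        by case: leP => _; rewrite ?subrr ?subr0.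
      by apply: cvgB; [exact: cvg_cst|apply: cutoff_cvg => //; exact: t01].
    pose D : set R := `[- L, L]%classic; rewrite -/D in cv t01 ltail *.
    have mD : measurable D by exact: measurable_itv.
    have lE : (\int[l]_(x in D) ((x0 < x)%R%:R : R)%:E = l `]x0, +oo[%classic)%E.
      transitivity (\int[l]_(x in D) (\1_(`]x0, +oo[%classic) x)%:E)%E.
        by apply: eq_integral => x _; rewrite indicE mem_setE /= in_itv /= andbT.
      rewrite integral_indic//.
      have mI : measurable (`]x0, +oo[%classic : set R) by exact: measurable_itv.
      rewrite [RHS](measureDI l mI mD).
      rewrite [X in _ = (X + _)%E](_ : _ = 0%E) ?add0e//.
      apply: (subset_measure0 _ _ _ ltail); [exact: measurableD|exact: measurableC|].
      by move=> x [].
    have mp n : measurable_fun setT (fun x : R => (p n).[x]).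
      by apply: continuous_measurable_fun => x; exact: continuous_horner.
    rewrite -lE; apply: fine_cvg; rewrite fineK; last first.
      by rewrite lE ge0_fin_numE// lfin.
    apply: (@dominated_cvg _ _ _ l D mD _ _ (fun=> 1%E)) => //.
    - by move=> n; apply/measurable_EFinP; apply: measurable_funTS; exact: mp.
    - by move=> x Dx; apply/cvg_EFin; [exact: nearW|exact: cv].
    - apply: (@bounded_integrable _ _ _ _ _ (cst 1) 1) => //; first exact: lfin.
      by move=> x _; rewrite normr1.
    - move=> n x Dx; rewrite /= lee_fin pE.
      have /andP[u0 u1] := t01 x Dx.
      set u := (x + L) / _ in u0 u1 *.
      have v0 : 0 <= u ^+ n.+1 by rewrite exprn_ge0.
      have v1 : u ^+ n.+1 <= 1 by rewrite exprn_ile1.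
      have z0 : 0 <= (1 - u ^+ n.+1) ^+ cutoff_exponent th n by rewrite exprn_ge0//; lra.
      have z1 : (1 - u ^+ n.+1) ^+ cutoff_exponent th n <= 1 by rewrite exprn_ile1//; lra.
      by rewrite ger0_norm; lra.
  have e n : \int[mu]_(x in `[- L, L]) (p n).[x] = \int[nu]_(x in `[- L, L]) (p n).[x].
    apply: eq_integral_poly => // k.
    - exact: moment_integrable mmu _ _.
    - exact: moment_integrable mnu _ _.
    - by rewrite !(moment_truncated _ K0 mK).
  have c1 := main _ mmu; have c2 := main _ mnu.
  have {}c1 : (fun n => \int[nu]_(x in `[- L, L]) (p n).[x]) @ \oo --> fine (mu `]x0, +oo[%classic).
    by move: c1; under eq_fun do rewrite e.
  have : fine (mu `]x0, +oo[%classic) = fine (nu `]x0, +oo[%classic) by exact: (cvg_unique _ c1 c2).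
  have fin (l : {measure set (measurableTypeR R) -> \bar R}) :
      (forall n, \int[l]_x (x ^+ n)%:E = (m n)%:E)%E -> l `]x0, +oo[%classic \is a fin_num.
    by move=> ml; rewrite ge0_fin_numE// (moment_finite ml).
  by move=> fE; rewrite -(fineK (fin _ mmu)) -(fineK (fin _ mnu)) fE.
- by move=> k; exact: (moment_finite mmu).
Qed.

End determinacy.

(** * Improper integrals as limits over compact segments *)

Section improper.
Context {R : realType}.
Notation mu := (@lebesgue_measure R).

Lemma FTC_is_derive (F f : R -> R) (a b : R) : a < b ->
  (forall x, a <= x <= b -> is_derive x 1 F (f x)) ->
  {within `[a, b], continuous f} ->
  \int[mu]_(x in `[a, b]) f x = F b - F a.
Proof.
move=> ab dF cf.
have cF x : a <= x <= b -> {for x, continuous F}.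
  by move=> /dF [dx _]; apply/differentiable_continuous/derivable1_diffP.
rewrite /Rintegral (@continuous_FTC2 _ f F a b)//.
- split=> [x|/=|/=].
  + by rewrite in_itv/= => /andP[/ltW ax /ltW xb]; case: (dF x _) => //; rewrite ax.
  + by apply: cvg_at_right_filter; apply: cF; rewrite lexx ltW.
  + by apply: cvg_at_left_filter; apply: cF; rewrite lexx ltW.
- move=> x; rewrite in_itv/= => /andP[/ltW ax /ltW xb].
  by case: (dF x _) => [|_ <-]; rewrite ?ax// derive1E.
Qed.

Lemma within_continuous_is_derive (F f : R -> R) (a b : R) :
  (forall x, a <= x <= b -> is_derive x 1 F (f x)) ->
  {within `[a, b], continuous F}.
Proof.
by move=> dF; apply: derivable_within_continuous => x; rewrite in_itv/= => /dF[].
Qed.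

Lemma segment_integrable (f : R -> R) (a b : R) :
  {within `[a, b], continuous f} -> mu.-integrable `[a, b] (EFin \o f).
Proof.
by move=> cf; apply: continuous_compact_integrable => //; exact: segment_compact.
Qed.

Lemma bigcup_segment_0y :
  \bigcup_i `[(i.+1%:R^-1 : R), i.+1%:R]%classic = `]0, +oo[%classic.
Proof.
apply/seteqP; split=> [x [i _]|x] /=; rewrite !in_itv/= ?andbT.
  by move=> /andP[+ _]; apply: lt_le_trans; rewrite invr_gt0.
move=> x0; exists (Num.trunc (Num.max x x^-1)) => //=.
have m0 : 0 <= Num.max x x^-1 by rewrite le_max ltW.
have /truncn_itv/andP[_ /ltW] := m0; rewrite ge_max => /andP[xn xVn].
by rewrite in_itv/= xn andbT -[leRHS]invrK lef_pV2 ?posrE ?invr_gt0.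
Qed.

Lemma cvg_ge0_integral_0y (f : R -> R) :
  (forall x, 0 < x -> 0 <= f x) -> measurable_fun setT f ->
  (fun i : nat => \int[mu]_(x in `[(i.+1%:R^-1)%R, i.+1%:R%R]) (f x)%:E)%E @ \oo -->
  (\int[mu]_(x in `]0%R, +oo[) (f x)%:E)%E.
Proof.
move=> f0 mf; rewrite -bigcup_segment_0y.
apply: ge0_nondecreasing_set_cvg_integral => //.
- apply/nondecreasing_seqP => n; rewrite subsetEset => x /=.
  rewrite !in_itv/= => /andP[nx xn]; apply/andP; split.
    by apply: le_trans nx; rewrite lef_pV2 ?posrE// ler_nat.
  by apply: le_trans xn _; rewrite ler_nat.
- by move=> i; apply/measurable_EFinP; exact: measurable_funTS.
- move=> i x /=; rewrite in_itv/= => /andP[ix _]; rewrite lee_fin f0//.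
  by apply: lt_le_trans ix; rewrite invr_gt0.
Qed.

End improper.

(** * Euler's integral: recurrence, finiteness and Wendel's inequality *)

Section gamma.
Context {R : realType}.
Notation mu := (@lebesgue_measure R).
Implicit Types s t x : R.

Definition gamma_integrand s x : R := x `^ (s - 1) * expR (- x).

Lemma gamma_integrand_ge0 s x : 0 <= gamma_integrand s x.
Proof. by rewrite mulr_ge0 ?powR_ge0 ?expR_ge0. Qed.

Lemma measurable_gamma_integrand s : measurable_fun setT (gamma_integrand s).
Proof.
apply: measurable_funM; first exact: measurable_powR.
by apply: measurableT_comp => //; exact: measurable_expR.
Qed.

Lemma is_derive_powR s x : 0 < x -> is_derive x 1 (fun y => y `^ s) (s * x `^ (s - 1)).
Proof.
move=> x0; apply: DeriveDef.
  by apply: derivable_powR; rewrite in_itv/= andbT.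
by rewrite -derive1E powR_derive1// in_itv/= andbT.
Qed.

Lemma is_derive_gamma s x : 0 < x ->
  is_derive x 1 (fun y => y `^ s * expR (- y))
    (s * gamma_integrand s x - gamma_integrand (s + 1) x).
Proof.
move=> x0; have dp := is_derive_powR s x0.
apply: is_derive_eq.
rewrite /gamma_integrand addrK /GRing.scale /=; ring.
Qed.

Lemma continuous_gamma_integrand s (a b : R) : 0 < a ->
  {within `[a, b], continuous (gamma_integrand s)}.
Proof.
move=> a0; apply: within_continuous_is_derive => x /andP[ax _].
by apply: is_derive_gamma; exact: lt_le_trans ax.
Qed.

(** The offset 2 keeps the endpoints distinct at [i = 0], as the fundamental theorem requires. *)
Definition gamma_trunc s (i : nat) : R :=
  \int[mu]_(x in `[i.+2%:R^-1, i.+2%:R]) gamma_integrand s x.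

(** The value in the extended reals lets the recurrence be proved before finiteness; a divergent
    integral would give [Gamma] the default value 0. *)
Definition ereal_gamma s : \bar R :=
  (\int[mu]_(x in `]0%R, +oo[) (gamma_integrand s x)%:E)%E.

Lemma ereal_gamma_ge0 s : (0 <= ereal_gamma s)%E.
Proof. by apply: integral_ge0 => x _; rewrite lee_fin gamma_integrand_ge0. Qed.

Lemma GammaE s : Gamma s = fine (ereal_gamma s).
Proof. by []. Qed.

Lemma cvg_gamma_trunc s : (fun i => (gamma_trunc s i)%:E) @ \oo --> ereal_gamma s.
Proof.
have := @cvg_ge0_integral_0y R _ (fun x _ => gamma_integrand_ge0 s x) (measurable_gamma_integrand s).
rewrite -cvg_shiftS; apply: cvg_trans; apply: near_eq_cvg; apply: nearW => i /=.
rewrite /gamma_trunc /Rintegral fineK//; apply: integrable_fin_num => //.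
by apply: segment_integrable; apply: continuous_gamma_integrand; rewrite invr_gt0.
Qed.

Lemma gamma_truncS s i : gamma_trunc (s + 1) i =
  s * gamma_trunc s i + (i.+2%:R^-1 `^ s * expR (- i.+2%:R^-1) - i.+2%:R `^ s * expR (- i.+2%:R)).
Proof.
have a0 : 0 < i.+2%:R^-1 :> R by rewrite invr_gt0.
have ab : i.+2%:R^-1 < i.+2%:R :> R.
  by rewrite (@lt_trans _ _ 1)// ?invf_lt1// ltr1n.
have c1 := @continuous_gamma_integrand s _ i.+2%:R a0.
have c2 := @continuous_gamma_integrand (s + 1) _ i.+2%:R a0.
have i1 := segment_integrable c1; have i2 := segment_integrable c2.
have i3 : mu.-integrable `[i.+2%:R^-1, i.+2%:R] (EFin \o (fun x => s * gamma_integrand s x)).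
  rewrite (_ : EFin \o _ = fun x => (s%:E * (gamma_integrand s x)%:E)%E).
    exact: integrableZl.
  by apply/funext => x; rewrite /= EFinM.
have := @FTC_is_derive R (fun y => y `^ s * expR (- y))
  (fun x => s * gamma_integrand s x - gamma_integrand (s + 1) x) _ _ ab.
rewrite RintegralB// RintegralZl// -/(gamma_trunc s i) -/(gamma_trunc (s + 1) i) => H.
have -> : gamma_trunc (s + 1) i = s * gamma_trunc s i -
   (s * gamma_trunc s i - gamma_trunc (s + 1) i) by ring.
suff -> : s * gamma_trunc s i - gamma_trunc (s + 1) i =
    i.+2%:R `^ s * expR (- i.+2%:R) - i.+2%:R^-1 `^ s * expR (- i.+2%:R^-1) by ring.
apply: H.
- by move=> x /andP[ax _]; apply: is_derive_gamma; exact: lt_le_trans ax.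
- move=> x; apply: cvgB; last exact: c2.
  by apply: cvgMr; exact: c1.
Qed.

Lemma powR_expR_cvg0 s : (fun i : nat => i.+2%:R `^ s * expR (- i.+2%:R)) @ \oo --> (0 : R).
Proof.
pose n := Num.trunc `|s|.
have sn : s <= n.+1%:R.
  apply: le_trans (ler_norm _) _; have /truncn_itv/andP[_ /ltW//] := normr_ge0 s.
have c : (fun i : nat => n.+2`!%:R * (i.+2%:R : R)^-1) @ \oo --> n.+2`!%:R * (0 : R).
  apply: cvgMr; have := @cvg_harmonic R; rewrite -cvg_shiftS; exact.
rewrite mulr0 in c; apply: (squeeze_cvgr _ (@cvg_cst _ (0 : R) _ \oo _) c).
apply: nearW => i /=; rewrite mulr_ge0 ?powR_ge0 ?expR_ge0//=.
have x0 : 0 < i.+2%:R :> R by [].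
have x1 : 1 <= i.+2%:R :> R by rewrite ler1n.
set x : R := i.+2%:R in x0 x1 *.
rewrite expRN ler_pdivrMr ?expR_gt0// mulrAC ler_pdivlMr//.
have f0 : 0 < n.+2`!%:R :> R by rewrite ltr0n fact_gt0.
have h := @expR_ge1Dxn R x n.+1 (ltW x0).
rewrite mulrC -ler_pdivrMl//.
apply: le_trans h; apply: (@le_trans _ _ (x ^+ n.+2 / n.+2`!%:R)); last by rewrite lerDr.
rewrite [leRHS]mulrC ler_pM2l ?invr_gt0// exprS ler_pM2l//.
by rewrite -powR_mulrn; [apply: ler_powR|exact: ltW].
Qed.

Lemma powR_expR_cvg0_inv s : 0 < s ->
  (fun i : nat => i.+2%:R^-1 `^ s * expR (- i.+2%:R^-1)) @ \oo --> (0 : R).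
Proof.
move=> s0.
have c : (fun i : nat => (i.+2%:R : R)^-1 `^ s) @ \oo --> (0 : R).
  have := powR_cvg0 s0 => /cvg_at_rightP; apply; split.
    by move=> n; rewrite invr_gt0.
  by have := @cvg_harmonic R; rewrite -cvg_shiftS; exact.
apply: (squeeze_cvgr _ (@cvg_cst _ (0 : R) _ \oo _) c).
apply: nearW => i /=; rewrite mulr_ge0 ?powR_ge0 ?expR_ge0//=.
by rewrite ler_piMr ?powR_ge0// -expR0 ler_expR oppr_le0.
Qed.

(** Integration by parts on the truncations. The boundary term at infinity vanishes for every [s];
    the one at 0 is where [0 < s] enters. *)
Lemma ereal_gammaS s : 0 < s -> ereal_gamma (s + 1) = (s%:E * ereal_gamma s)%E.
Proof.
move=> s0.
have c1 := @cvg_gamma_trunc (s + 1).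
have c2 : (fun i => (gamma_trunc (s + 1) i)%:E) @ \oo --> (s%:E * ereal_gamma s + 0)%E.
  pose r i : R := i.+2%:R^-1 `^ s * expR (- i.+2%:R^-1) - i.+2%:R `^ s * expR (- i.+2%:R).
  have cr : r @ \oo --> (0 : R).
    rewrite -[X in _ --> X]subr0.
    by apply: cvgB; [exact: powR_expR_cvg0_inv|exact: powR_expR_cvg0].
  rewrite (_ : (fun i => _) = (fun i => s%:E * (gamma_trunc s i)%:E) \+ (fun i => (r i)%:E))%E; last first.
    by apply/funext => i; rewrite gamma_truncS EFinD EFinM.
  apply: cvgeD; first by rewrite fin_num_adde_defl.
    by apply: cvgeZl => //; exact: cvg_gamma_trunc.
  by apply/cvg_EFin; [exact: nearW|exact: cr].
have -> : ereal_gamma (s + 1) = (s%:E * ereal_gamma s + 0)%E by exact: (cvg_unique _ c1 c2).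
by rewrite adde0.
Qed.

Lemma ereal_gamma1 : ereal_gamma 1 = 1%E.
Proof.
rewrite /ereal_gamma integral_itv_obnd_cbnd; last first.
  by apply/measurable_EFinP/measurable_funTS; exact: measurable_gamma_integrand.
transitivity (\int[mu]_(x in `[0%R, +oo[) (exponential_pdf 1 x)%:E)%E.
  apply: eq_integral => x; rewrite inE/= in_itv/= andbT => x0.
  by rewrite exponential_pdfE// /gamma_integrand subrr powRr0 mulN1r.
have := @integral_exponential_pdf R 1 ltr01.
have mE : measurable_fun setT (EFin \o exponential_pdf (1 : R)).
  by apply/measurable_EFinP; exact: measurable_exponential_pdf.
rewrite -(setUv `[0, +oo[%classic) ge0_integral_setU//=; last 4 first.
- exact: measurableC.
- by rewrite setUv.
- by move=> x _; rewrite lee_fin exponential_pdf_ge0.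
- exact/disj_setPCl.
rewrite [X in (_ + X)%E]integral0_eq ?adde0//.
by move=> x x0; rewrite /exponential_pdf patchE ifF// memNset.
Qed.

Lemma ereal_gamma_nat n : ereal_gamma n.+1%:R = (n`!%:R)%:E.
Proof.
elim: n => [|n IH]; first by rewrite ereal_gamma1.
by rewrite -natr1 ereal_gammaS// IH -EFinM -natrM factS.
Qed.

(** For [t >= 1] the factor [x^(t - 1)] is at most [1 + x^(n + 1)], which leaves two integer
    arguments. For [s < 1] the recurrence brings finiteness down from [s + 1]. *)
Lemma ereal_gamma_fin s : 0 < s -> ereal_gamma s \is a fin_num.
Proof.
have big t : 1 <= t -> ereal_gamma t \is a fin_num.
  move=> t1; rewrite ge0_fin_numE ?ereal_gamma_ge0//.
  pose n := Num.trunc t.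
  have tn : t <= n.+1%:R.
    by have /truncn_itv/andP[_ /ltW//] : 0 <= t by rewrite (le_trans _ t1).
  apply: (@le_lt_trans _ _ (ereal_gamma 1 + ereal_gamma n.+2%:R)%E); last first.
    by rewrite ereal_gamma1 ereal_gamma_nat -EFinD ltry.
  rewrite -ge0_integralD//; first last.
  - by apply/measurable_EFinP/measurable_funTS; exact: measurable_gamma_integrand.
  - by move=> x _; rewrite lee_fin gamma_integrand_ge0.
  - by apply/measurable_EFinP/measurable_funTS; exact: measurable_gamma_integrand.
  - by move=> x _; rewrite lee_fin gamma_integrand_ge0.
  apply: ge0_le_integral => //.
  - by move=> x _; rewrite lee_fin gamma_integrand_ge0.
  - by apply/measurable_EFinP/measurable_funTS; exact: measurable_gamma_integrand.
  - apply/measurable_EFinP/measurable_funTS.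
    by apply: measurable_funD; exact: measurable_gamma_integrand.
  move=> x /=; rewrite in_itv/= andbT => x0; rewrite -EFinD lee_fin.
  rewrite /gamma_integrand -mulrDl ler_pM2r ?expR_gt0// subrr powRr0.
  have [x1|x1] := leP x 1.
    rewrite (@le_trans _ _ 1)// ?lerDl ?powR_ge0//.
    have := @ger_powR R x _ 0 (t - 1); rewrite powRr0; apply; first by rewrite x0.
    by rewrite subr_ge0.
  rewrite (@le_trans _ _ (x `^ (n.+2%:R - 1)))// ?lerDr//.
  apply: ler_powR; first exact: ltW.
  by rewrite lerD2r (le_trans tn)// ler_nat.
move=> s0; have [s1|s1] := leP 1 s; first exact: big.
have := big (s + 1); rewrite lerDr => /(_ (ltW s0)); rewrite ereal_gammaS//.
have := ereal_gamma_ge0 s; case: (ereal_gamma s) => //= _.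
by rewrite gt0_muley ?lte_fin.
Qed.

Lemma GammaS s : 0 < s -> Gamma (s + 1) = s * Gamma s.
Proof. by move=> s0; rewrite !GammaE ereal_gammaS// fineM//= ereal_gamma_fin. Qed.

Lemma Gamma_nat n : Gamma n.+1%:R = n`!%:R :> R.
Proof. by rewrite GammaE ereal_gamma_nat. Qed.

(** Weighted arithmetic-geometric mean of [r] and 1, here as Young's inequality with conjugate
    exponents [1/t] and [1/(1 - t)]. *)
Lemma powR_le_affine (r t : R) : 0 < r -> 0 <= t <= 1 -> r `^ t <= 1 - t + t * r.
Proof.
move=> r0 /andP[t0 t1].
have [->|tN0] := eqVneq t 0; first by rewrite powRr0 mul0r subr0 addr0.
have [->|tN1] := eqVneq t 1; first by rewrite subrr add0r mul1r powRr1// ltW.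
have t0' : 0 < t by rewrite lt_neqAle eq_sym tN0.
have t1' : t < 1 by rewrite lt_neqAle tN1.
have q0 : 0 < (1 - t)^-1 by rewrite invr_gt0 subr_gt0.
have p0 : 0 < t^-1 by rewrite invr_gt0.
have pq : t^-1^-1 + (1 - t)^-1^-1 = 1 by rewrite !invrK subrKC.
have := conjugate_powR (powR_ge0 r t) ler01 p0 q0 pq.
have -> : 1 `^ (1 - t)^-1 = 1 :> R by rewrite powR1.
by rewrite !invrK mulr1 -powRrM mulfV// powRr1 ?(ltW r0)// mul1r addrC [t * r]mulrC.
Qed.

(** Integrate [u^t <= x^t (1 - t + t u / x)] against [u^(x - 1) e^(-u)]: since
    [Gamma (x + 1) = x Gamma x], the affine factor contributes exactly [Gamma x]. *)
Lemma Gamma_wendel (x t : R) : 0 < x -> 0 <= t <= 1 -> Gamma (x + t) <= x `^ t * Gamma x.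
Proof.
move=> x0 t01; have /andP[t0 t1] := t01.
have xt0 : 0 < x + t by rewrite ltr_wpDr.
rewrite !GammaE -lee_fin EFinM !fineK ?ereal_gamma_fin//.
pose c1 := x `^ t * (1 - t); pose c2 := x `^ t * (t / x).
have c10 : 0 <= c1 by rewrite mulr_ge0 ?powR_ge0// subr_ge0.
have c20 : 0 <= c2 by rewrite mulr_ge0 ?powR_ge0// divr_ge0// ltW.
have -> : ((x `^ t)%:E * ereal_gamma x = c1%:E * ereal_gamma x + c2%:E * ereal_gamma (x + 1))%E.
  rewrite ereal_gammaS// -(fineK (ereal_gamma_fin x0)) -!EFinM -EFinD; congr EFin.
  by rewrite /c1 /c2; field; rewrite gt_eqF.
have mg s : measurable_fun (`]0%R, +oo[%classic : set R) (fun u => (gamma_integrand s u)%:E).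
  by apply/measurable_EFinP/measurable_funTS; exact: measurable_gamma_integrand.
have g0 s u : (0 <= (gamma_integrand s u)%:E)%E by rewrite lee_fin gamma_integrand_ge0.
rewrite /ereal_gamma -2?ge0_integralZl_EFin//; do ?exact: mg.
rewrite -ge0_integralD//; first last.
- by apply: measurable_funeM; exact: mg.
- by move=> u _; rewrite mule_ge0.
- by apply: measurable_funeM; exact: mg.
- by move=> u _; rewrite mule_ge0.
apply: ge0_le_integral => //.
- exact: mg.
- by apply: emeasurable_funD; apply: measurable_funeM; exact: mg.
move=> u /=; rewrite in_itv/= andbT => u0.
rewrite -!EFinM -EFinD lee_fin /gamma_integrand.
rewrite !mulrA -mulrDl ler_pM2r ?expR_gt0//.
have uN0 : u != 0 by rewrite gt_eqF.
have -> : u `^ (x + t - 1) = u `^ (x - 1) * u `^ t.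
  by rewrite -powRD ?uN0 ?implybT//; congr (_ `^ _); ring.
have -> : u `^ (x + 1 - 1) = u `^ (x - 1) * u.
  by rewrite -{3}(powRr1 (ltW u0)) -powRD ?uN0 ?implybT//; congr (_ `^ _); ring.
have -> : u `^ t = x `^ t * (u / x) `^ t.
  by rewrite -powRM ?ltW ?divr_gt0//; congr (_ `^ _); field; rewrite gt_eqF.
have h : (u / x) `^ t <= 1 - t + t * (u / x) by apply: powR_le_affine => //; rewrite divr_gt0.
have -> : c1 * u `^ (x - 1) + c2 * (u `^ (x - 1) * u) = u `^ (x - 1) * (x `^ t * (1 - t + t * (u / x))).
  by rewrite /c1 /c2; ring.
by rewrite ler_pM2l ?powR_gt0// ler_pM2l ?powR_gt0.
Qed.

(** Wendel's inequality from [s] up to the next integer bounds a positive multiple of [Gamma s]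
    below by a factorial. *)
Lemma Gamma_gt0 s : 0 < s -> 0 < Gamma s.
Proof.
move=> s0; have /truncn_itv/andP[] := ltW s0; set n := Num.trunc s => ns sn.
have t01 : 0 <= n.+1%:R - s <= 1.
  by rewrite -natr1 in sn *; apply/andP; split; lra.
have := Gamma_wendel s0 t01; rewrite subrKC Gamma_nat => h.
have : 0 < s `^ (n.+1%:R - s) * Gamma s.
  by apply: lt_le_trans h; rewrite ltr0n fact_gt0.
by rewrite pmulr_rgt0// powR_gt0.
Qed.

Lemma Gamma_wendel_lower (x t : R) : 0 < x -> 0 <= t <= 1 ->
  x * Gamma x <= (x + t) `^ (1 - t) * Gamma (x + t).
Proof.
move=> x0 /andP[t0 t1]; have xt0 : 0 < x + t by rewrite ltr_wpDr.
rewrite -GammaS//; have -> : x + 1 = x + t + (1 - t) by ring.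
by apply: Gamma_wendel => //; apply/andP; split; lra.
Qed.

End gamma.

(** * The value at 1/2 and asymptotic ratios of Gamma *)

Section gamma_half.
Context {R : realType}.
Notation mu := (@lebesgue_measure R).

Lemma gamma_integrand_half (y : R) : 0 < y ->
  gamma_integrand 2^-1 (y ^+ 2) * (2 * y) = 2 * gauss_fun y.
Proof.
move=> y0; rewrite /gamma_integrand /gauss_fun.
have -> : 2^-1 - 1 = - 2^-1 :> R by field.
rewrite powRN powR12_sqrt ?sqr_ge0// sqrtr_sqr gtr0_norm//.
by field; rewrite gt_eqF.
Qed.

Lemma gamma_half_substitution (a b : R) : 0 < a -> a <= b ->
  (\int[mu]_(x in `[(a ^+ 2)%R, (b ^+ 2)%R]) (gamma_integrand 2^-1 x)%:E =
   \int[mu]_(x in `[a, b]) (2 * gauss_fun x)%:E)%E.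
Proof.
move=> a0 ab.
have dF (x : R) : is_derive x 1 (fun y : R => y ^+ 2) (2 * x).
  by apply: is_derive_eq; rewrite /GRing.scale /=; ring.
have F'E : (fun y : R => y ^+ 2)^`()%classic = fun x => 2 * x.
  by apply/funext => x; rewrite derive1E; case: (dF x).
rewrite (@integration_by_substitution_increasing R (fun y => y ^+ 2) _ a b)//.
- apply: eq_integral => x; rewrite inE/= in_itv/= => /andP[ax _].
  by rewrite F'E /= -[LHS]/((_ * _)%:E) gamma_integrand_half// (lt_le_trans a0).
- move=> x y; rewrite !in_itv/= => /andP[ax _] /andP[ay _] xy.
  by rewrite !expr2; nra.
- by move=> x _; rewrite F'E; apply: cvgMr; exact: cvg_id.
- rewrite F'E; apply/cvg_ex; exists (2 * a).
  by apply: cvgMr; apply: cvg_at_right_filter; exact: cvg_id.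
- rewrite F'E; apply/cvg_ex; exists (2 * b).
  by apply: cvgMr; apply: cvg_at_left_filter; exact: cvg_id.
- split=> [x _|/=|/=]; first by case: (dF x).
  + by apply: cvg_at_right_filter; exact: exprn_continuous.
  + by apply: cvg_at_left_filter; exact: exprn_continuous.
- by apply: continuous_gamma_integrand; rewrite exprn_gt0.
Qed.

(** The substitution [x = y^2] turns Euler's integral into twice the Gaussian integral over the
    half-line. *)
Lemma Gamma_half : Gamma 2^-1 = Num.sqrt pi :> R.
Proof.
rewrite GammaE; suff -> : ereal_gamma 2^-1 = (Num.sqrt pi : R)%:E by [].
have := @cvg_ge0_integral_0y R _ (fun x _ => gamma_integrand_ge0 2^-1 x) (measurable_gamma_integrand 2^-1).
move=> c1.
have c2 : (fun i : nat => \int[mu]_(x in `[((i.+1%:R^-1) ^+ 2)%R, (i.+1%:R ^+ 2)%R]) (gamma_integrand 2^-1 x)%:E)%E @ \oo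
   --> ereal_gamma 2^-1.
  (* Squaring maps the segment of index [i] onto the one of index [(i + 1)^2 - 1], so a subsequence
     of the truncations is taken. *)
  have sub : (fun i : nat => (i.+1 ^ 2).-1) @ \oo --> \oo.
    move=> A [N _ HN]; exists N => // i /= Ni; apply: HN => /=; nia.
  have := cvg_comp _ _ sub c1.
  apply: cvg_trans; apply: near_eq_cvg; apply: nearW => i; rewrite /comp.
  by rewrite prednK ?expn_gt0// natrX exprVn.
have m2g : measurable_fun setT (fun x : R => 2 * gauss_fun x).
  by apply: measurable_funM => //; exact: measurable_gauss_fun.
have c3 := @cvg_ge0_integral_0y R (fun x => 2 * gauss_fun x) (fun x _ => mulr_ge0 (ler0n _ 2) (gauss_fun_ge0 x)) m2g.
have {}c3 : (fun i : nat => \int[mu]_(x in `[((i.+1%:R^-1) ^+ 2)%R, (i.+1%:R ^+ 2)%R]) (gamma_integrand 2^-1 x)%:E)%E @ \oo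
   --> (\int[mu]_(x in `]0%R, +oo[) (2 * gauss_fun x)%:E)%E.
  move: c3; apply: cvg_trans; apply: near_eq_cvg; apply: nearW => i /=.
  rewrite gamma_half_substitution// (@le_trans _ _ 1)// ?ler1n//.
  by rewrite invf_le1// ler1n.
have -> : ereal_gamma 2^-1 = (\int[mu]_(x in `]0%R, +oo[) (2 * gauss_fun x)%:E)%E.
  exact: (cvg_unique _ c2 c3).
rewrite integral_itv_obnd_cbnd; last by apply/measurable_EFinP/measurable_funTS.
under eq_integral do rewrite EFinM.
rewrite ge0_integralZl_EFin//; last 2 first.
- by move=> x _; rewrite lee_fin gauss_fun_ge0.
- by apply/measurable_EFinP/measurable_funTS; exact: measurable_gauss_fun.
by rewrite integral0y_gauss -EFinM mulrC divfK.
Qed.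

Definition wendel_ratio (x t : R) : R := Gamma (x + t) / (Gamma x * x `^ t).

Lemma wendel_ratio_gt0 (x t : R) : 0 < x -> 0 <= t -> 0 < wendel_ratio x t.
Proof.
move=> x0 t0; apply: divr_gt0; first by apply: Gamma_gt0; exact: ltr_wpDr.
by apply: mulr_gt0; [exact: Gamma_gt0|exact: powR_gt0].
Qed.

Lemma wendel_ratioE (x t : R) : 0 < x ->
  Gamma (x + t) = wendel_ratio x t * (Gamma x * x `^ t).
Proof.
by move=> x0; rewrite divfK// gt_eqF// mulr_gt0 ?Gamma_gt0 ?powR_gt0.
Qed.

(** Wendel's inequality at [x + t] with increment [1 - t] gives the lower bound
    [(x / (x + t))^(1 - t)], weakened here to a rational function. *)
Lemma wendel_ratio_bounds (x t : R) : 0 < x -> 0 <= t <= 1 ->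
  x / (x + t) <= wendel_ratio x t <= 1.
Proof.
move=> x0 t01; have /andP[t0 t1] := t01.
have xt0 : 0 < x + t by rewrite ltr_wpDr.
have G0 := Gamma_gt0 x0; have p0 : 0 < x `^ t by rewrite powR_gt0.
apply/andP; split; last first.
  by rewrite ler_pdivrMr ?mulr_gt0// mul1r mulrC; exact: Gamma_wendel.
have Gp : 0 < Gamma x * x `^ t by exact: mulr_gt0.
rewrite (ler_pdivlMr _ _ Gp).
have q0 : 0 < (x + t) `^ (1 - t) by rewrite powR_gt0.
rewrite -(ler_pM2l q0); apply: le_trans (Gamma_wendel_lower x0 t01).
have E : x / (x + t) = (x / (x + t)) `^ t * (x / (x + t)) `^ (1 - t).
  rewrite -powRD; last by rewrite subrKC oner_eq0.
  by rewrite subrKC powRr1// ltW// divr_gt0.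
have y0 : 0 < x / (x + t) by rewrite divr_gt0.
have y1 : x / (x + t) <= 1 by rewrite ler_pdivrMr// mul1r lerDl.
have -> : (x + t) `^ (1 - t) * (x / (x + t) * (Gamma x * x `^ t)) =
  Gamma x * (x / (x + t)) `^ t * x `^ t * ((x + t) * (x / (x + t))) `^ (1 - t).
  rewrite [((x + t) * _) `^ _]powRM ?ltW// {1}E; ring.
rewrite mulrCA divff ?gt_eqF// mulr1.
have -> : Gamma x * (x / (x + t)) `^ t * x `^ t * x `^ (1 - t) = (x / (x + t)) `^ t * (Gamma x * (x `^ t * x `^ (1 - t))) by ring.
have -> : x `^ t * x `^ (1 - t) = x.
  by rewrite -powRD ?subrKC ?oner_eq0// powRr1// ltW.
rewrite mulrC [Gamma x * x]mulrC ler_piMr//; first by rewrite mulr_ge0// ltW.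
rewrite -(powRr0 (x / (x + t))); apply: ger_powR => //; exact/andP.
Qed.

Lemma cvg_wendel_ratio (x : nat -> R) (t : R) : 0 <= t <= 1 ->
  (forall n, n%:R + 2^-1 <= x n) -> (fun n => wendel_ratio (x n) t) @ \oo --> (1 : R).
Proof.
move=> t01 xn; have /andP[t0 t1] := t01.
have c : (fun n => 1 - 2 * harmonic n) @ \oo --> (1 - 2 * 0 : R).
  by apply: cvgB; [exact: cvg_cst|apply: cvgMr; exact: cvg_harmonic].
rewrite mulr0 subr0 in c.
apply: (squeeze_cvgr _ c (@cvg_cst _ (1 : R) _ \oo _)).
apply: nearW => n /=.
have n0 : 0 <= n%:R :> R by [].
have x0 : 0 < x n by apply: lt_le_trans (xn n); lra.
have /andP[h1 ->] := wendel_ratio_bounds x0 t01; rewrite andbT; apply: le_trans h1.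
rewrite ler_pdivlMr; last by lra.
rewrite mulrBl mul1r lerBlDr lerD2l.
rewrite -mulrA mulrCA ler_pdivlMl// -natr1.
by have := xn n; nra.
Qed.

Lemma powR_ratio_cvg1 (s : R) : 0 <= s <= 1 ->
  (fun n : nat => (n%:R + 2^-1) `^ s / (n%:R + 1) `^ s) @ \oo --> (1 : R).
Proof.
move=> /andP[s0 s1].
have c : (fun n => 1 - 2^-1 * harmonic n) @ \oo --> (1 - 2^-1 * 0 : R).
  by apply: cvgB; [exact: cvg_cst|apply: cvgMr; exact: cvg_harmonic].
rewrite mulr0 subr0 in c.
apply: (squeeze_cvgr _ c (@cvg_cst _ (1 : R) _ \oo _)).
apply: nearW => n /=.
have n0 : 0 <= n%:R :> R by [].
have a0 : 0 < n%:R + 2^-1 :> R by lra.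
have b0 : 0 < n%:R + 1 :> R by lra.
rewrite ler_pdivrMr ?powR_gt0// mul1r.
apply/andP; split; last by apply: ge0_ler_powR => //; rewrite ?nnegrE; lra.
have -> : 1 - 2^-1 * harmonic n = (n%:R + 2^-1) / (n%:R + 1) :> R.
  by rewrite /harmonic /= -natr1; field; rewrite gt_eqF.
have -> : (n%:R + 2^-1) `^ s / (n%:R + 1) `^ s = ((n%:R + 2^-1) / (n%:R + 1)) `^ s :> R.
  rewrite powRM ?invr_ge0 ?ltW//; congr (_ * _).
  by rewrite -[in RHS]powR_inv1 ?ltW// powRAC powR_inv1// powR_ge0.
apply: ger1_powR => //; rewrite divr_gt0//= ler_pdivrMr// mul1r; lra.
Qed.

End gamma_half.

(** * Legendre's duplication formula and the central binomial at real arguments *)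

Section duplication.
Context {R : realType}.
Opaque Gamma.
Implicit Types s t x : R.

Lemma eq_cvgn (u v : nat -> R) (l : R) : u =1 v -> v @ \oo --> l -> u @ \oo --> l.
Proof. by move=> /funext ->. Qed.

(** The quotient of the two sides of Legendre's duplication formula, to be proved equal to 1. *)
Definition legendre s : R :=
  Gamma (2 * s + 1) * Num.sqrt pi / (2 `^ (2 * s) * (Gamma (s + 2^-1) * Gamma (s + 1))).

Lemma Gamma1 : Gamma 1 = 1 :> R.
Proof. exact: (@Gamma_nat R 0). Qed.

Lemma sqrt_pi_gt0 : 0 < Num.sqrt pi :> R.
Proof. by rewrite sqrtr_gt0 pi_gt0. Qed.

Lemma legendre0 : legendre 0 = 1.
Proof.
rewrite /legendre mulr0 !add0r Gamma1 Gamma_half powRr0 mulr1 !mul1r divff//.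
by rewrite gt_eqF// sqrt_pi_gt0.
Qed.

(** The shift by 1/2 exchanges the two Gamma factors of the denominator, up to one use of the
    recurrence above and below. *)
Lemma legendre_half_period s : 0 <= s -> legendre (s + 2^-1) = legendre s.
Proof.
move=> s0; rewrite /legendre.
have -> : 2 * (s + 2^-1) = 2 * s + 1 :> R by field.
have -> : s + 2^-1 + 2^-1 = s + 1 :> R by field.
rewrite [Gamma (2 * s + 1 + 1)]GammaS; last by lra.
rewrite [Gamma (s + 2^-1 + 1)]GammaS; last by lra.
rewrite powRD ?pnatr_eq0 ?implybT// powRr1//.
have g1 : Gamma (s + 2^-1) != 0 by rewrite gt_eqF// Gamma_gt0//; lra.
have g2 : Gamma (s + 1) != 0 by rewrite gt_eqF// Gamma_gt0//; lra.
have p0 : 2 `^ (2 * s) != 0 :> R by rewrite gt_eqF// powR_gt0.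
have h1 : s + 2^-1 != 0 by rewrite gt_eqF//; lra.
have -> : 2 * s + 1 = 2 * (s + 2^-1) by field.
move: (Gamma (2 * _)) (Gamma (s + 2^-1)) g1 (Gamma (s + 1)) g2 (2 `^ _) p0 (Num.sqrt pi).
move: (s + 2^-1) h1; clear => ? ? ? ? ? ? ? ? ? ?.
by field; do ?(apply/andP; split).
Qed.

Lemma legendre_period s k : 0 <= s -> legendre (s + k%:R * 2^-1) = legendre s.
Proof.
move=> s0; elim: k => [|k IH]; first by rewrite mul0r addr0.
rewrite -natr1 mulrDl mul1r addrA legendre_half_period//.
by rewrite addr_ge0// mulr_ge0.
Qed.

(** The restriction [s <= 1/2] keeps the increment [2 * s] of the numerator within the range of
    Wendel's inequality; one half-period is enough. *)
Lemma legendre_cvg s : 0 <= s <= 2^-1 -> (fun n : nat => legendre (s + n%:R)) @ \oo --> (1 : R).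
Proof.
move=> /andP[s0 s1].
have s01 : 0 <= s <= 1 by rewrite s0/=; lra.
have c1 := @cvg_wendel_ratio R (fun n => 2 * n%:R + 1) (2 * s) ltac:(apply/andP; split; lra)
  ltac:(move=> n /=; have : 0 <= n%:R :> R by []; lra).
have c2 := @cvg_wendel_ratio R (fun n => n%:R + 2^-1) s s01 ltac:(move=> n /=; lra).
have c3 := @cvg_wendel_ratio R (fun n => n%:R + 1) s s01 ltac:(move=> n /=; lra).
have c4 := powR_ratio_cvg1 s01.
rewrite -[X in _ --> X](_ : 1 * (1^-1 * 1^-1 * 1) = 1 :> R); last by rewrite invr1 !mulr1.
apply: (@eq_cvgn _ (fun n => wendel_ratio (2 * n%:R + 1) (2 * s) *
    ((wendel_ratio (n%:R + 2^-1) s)^-1 * (wendel_ratio (n%:R + 1) s)^-1 *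
     ((n%:R + 2^-1) `^ s / (n%:R + 1) `^ s)))); last first.
  by apply: cvgM => //; apply: cvgM => //; apply: cvgM; exact: cvgV (oner_neq0 _) _.
move=> n.
have n0 : 0 <= n%:R :> R by [].
have a0 : 0 < n%:R + 2^-1 :> R by lra.
have b0 : 0 < n%:R + 1 :> R by lra.
have d0 : 0 < 2 * n%:R + 1 :> R by lra.
(* The formula is already known at integers, by periodicity from 0. Comparison with it cancels
   everything but Wendel ratios and powers. *)
have L1 : legendre n%:R = 1.
  have := @legendre_period 0 (2 * n)%N (lexx _).
  by rewrite legendre0 add0r natrM mulrAC mulfV ?pnatr_eq0// mul1r.
rewrite /legendre in L1 *.
have -> : 2 * (s + n%:R) + 1 = 2 * n%:R + 1 + 2 * s by ring.
have -> : s + n%:R + 2^-1 = n%:R + 2^-1 + s by ring.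
have -> : s + n%:R + 1 = n%:R + 1 + s by ring.
rewrite (wendel_ratioE _ d0) (wendel_ratioE _ a0) (wendel_ratioE _ b0).
set G1 := Gamma (2 * _ + 1) in L1 *; set G2 := Gamma (_ + 2^-1) in L1 *.
set G3 := Gamma (_ + 1) in L1 *.
have G10 : 0 < G1 by exact: Gamma_gt0.
have G20 : 0 < G2 by exact: Gamma_gt0.
have G30 : 0 < G3 by exact: Gamma_gt0.
have w2 : wendel_ratio (n%:R + 2^-1) s != 0 by rewrite gt_eqF// wendel_ratio_gt0.
have w3 : wendel_ratio (n%:R + 1) s != 0 by rewrite gt_eqF// wendel_ratio_gt0.
have -> : (2 * n%:R + 1) `^ (2 * s) = 2 `^ (2 * s) * ((n%:R + 2^-1) `^ s * (n%:R + 2^-1) `^ s).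
  have -> : 2 * n%:R + 1 = 2 * (n%:R + 2^-1) :> R by field.
  rewrite powRM// ?ltW//; congr (_ * _); rewrite mulrDl !mul1r.
  by rewrite powRD// (gt_eqF a0) implybT.
have -> : 2 * (s + n%:R) = 2 * s + 2 * n%:R by ring.
have p1 : 2 `^ (2 * s) != 0 :> R by rewrite gt_eqF// powR_gt0.
have p2 : 2 `^ (2 * n%:R) != 0 :> R by rewrite gt_eqF// powR_gt0.
have p3 : (n%:R + 2^-1) `^ s != 0 :> R by rewrite gt_eqF// powR_gt0.
have p4 : (n%:R + 1) `^ s != 0 :> R by rewrite gt_eqF// powR_gt0.
rewrite [2 `^ (2 * s + _)]powRD ?pnatr_eq0 ?implybT//.
have sp := sqrt_pi_gt0; rewrite -[RHS]mulr1 -[X in _ = _ * X]L1.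
move: (wendel_ratio _ _) w2 (wendel_ratio _ _) w3 (wendel_ratio _ _).
move: (2 `^ _) p1 (2 `^ _) p2 ((n%:R + 2^-1) `^ s) p3 ((n%:R + 1) `^ s) p4.
clearbody G1 G2 G3; move: (Num.sqrt pi) sp => q q0.
clear -G20 G30 q0 => ? ? ? ? ? ? ? ? ? ? ? ? ?.
by field; do ?(apply/andP; split) => //; rewrite ?gt_eqF.
Qed.

Lemma legendreE s : 0 <= s -> legendre s = 1.
Proof.
move=> s0.
have t0 : 0 <= 2 * s by lra.
have /truncn_itv/andP[] := t0; set k := Num.trunc (2 * s) => k1 k2.
rewrite -natr1 in k2.
pose r := s - k%:R * 2^-1.
have r01 : 0 <= r <= 2^-1 by rewrite /r; apply/andP; split; lra.
have /andP[r0 r1] := r01.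
have -> : s = r + k%:R * 2^-1 by rewrite /r subrK.
rewrite legendre_period//.
have c := legendre_cvg r01.
have {}c : (fun n : nat => legendre r) @ \oo --> (1 : R).
  apply: cvg_trans c; apply: near_eq_cvg; apply: nearW => n /=.
  rewrite -(@legendre_period r (2 * n)%N r0); congr legendre.
  by rewrite natrM mulrAC mulfV ?pnatr_eq0// mul1r.
exact: (cvg_unique _ (@cvg_cst _ (legendre r) _ \oo _) c).
Qed.

(* The normalised central binomial [B_s / 4^s] at a real argument [s]. *)
Definition cbin_ratio s : R := Gamma (s + 2^-1) / (Num.sqrt pi * Gamma (s + 1)).

Lemma cbin_ratio_gt0 s : 0 <= s -> 0 < cbin_ratio s.
Proof.
by move=> s0; rewrite divr_gt0 ?mulr_gt0 ?Gamma_gt0 ?sqrt_pi_gt0//; lra.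
Qed.

Lemma cbin_ratio0 : cbin_ratio 0 = 1.
Proof.
by rewrite /cbin_ratio !add0r Gamma1 Gamma_half mulr1 divff// gt_eqF// sqrt_pi_gt0.
Qed.

Lemma cbin_ratioS s : 0 <= s ->
  cbin_ratio (s + 1) = (s + 2^-1) / (s + 1) * cbin_ratio s.
Proof.
move=> s0; rewrite /cbin_ratio.
have -> : s + 1 + 2^-1 = s + 2^-1 + 1 by ring.
rewrite GammaS ?[Gamma (s + 1 + 1)]GammaS; [|lra..].
have g2 : Gamma (s + 1) != 0 by rewrite gt_eqF// Gamma_gt0//; lra.
have h1 : s + 1 != 0 by rewrite gt_eqF//; lra.
have sp : Num.sqrt pi != 0 :> R by rewrite gt_eqF// sqrt_pi_gt0.
by field; rewrite g2 h1 sp.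
Qed.

Lemma cbin_ratio_duplication s : 0 <= s ->
  2 `^ (2 * s) / Num.sqrt pi * (Gamma (s + 2^-1) / Gamma (s + 1)) =
  Gamma (2 * s + 1) / Gamma (s + 1) ^+ 2.
Proof.
move=> s0; have := legendreE s0; rewrite /legendre.
have g1 : Gamma (s + 2^-1) != 0 by rewrite gt_eqF// Gamma_gt0//; lra.
have g2 : Gamma (s + 1) != 0 by rewrite gt_eqF// Gamma_gt0//; lra.
have p0 : 2 `^ (2 * s) != 0 :> R by rewrite gt_eqF// powR_gt0.
have sp : Num.sqrt pi != 0 :> R by rewrite gt_eqF// sqrt_pi_gt0.
move=> /divr1_eq E.
apply: (mulIf sp); rewrite -[RHS]mulrAC E.
by field; rewrite g2 sp.
Qed.

Lemma cbin_ratio_gammaE s :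
  2 `^ (2 * s) / Num.sqrt pi * (Gamma (s + 2^-1) / Gamma (s + 1)) =
  2 `^ (2 * s) * cbin_ratio s.
Proof. by rewrite /cbin_ratio invfM; ring. Qed.

Lemma central_binomialS n :
  central_binomial R n.+1 = (4 * n%:R + 2) / (n%:R + 1) * central_binomial R n.
Proof.
have E : (n.+1 * 'C(2 * n.+1, n.+1) = (4 * n + 2) * 'C(2 * n, n))%N.
  have f1 := @bin_fact (2 * n.+1) n.+1 ltac:(lia).
  have f2 := @bin_fact (2 * n) n ltac:(lia).
  have e1 : (2 * n.+1 - n.+1 = n.+1)%N by lia.
  have e2 : (2 * n - n = n)%N by lia.
  have e3 : (2 * n.+1 = (2 * n).+2)%N by lia.
  rewrite e1 in f1; rewrite e2 in f2.
  have f0 : (0 < n`! * n`! * n.+1)%N by rewrite !muln_gt0 !fact_gt0.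
  apply/eqP; rewrite -(eqn_pmul2r f0); apply/eqP.
  transitivity ('C(2 * n.+1, n.+1) * (n.+1`! * n.+1`!))%N; first by rewrite !factS; ring.
  by rewrite f1 e3 !factS -f2; ring.
rewrite /central_binomial; have := congr1 (fun k => k%:R : R) E.
rewrite /= !natrM natrD !natrM -natr1 => H.
have n1 : n%:R + 1 != 0 :> R by rewrite natr1 pnatr_eq0.
by rewrite mulrAC -H mulrAC mulfV// mul1r.
Qed.

Lemma central_binomialE n : central_binomial R n = 4 ^+ n * cbin_ratio n%:R.
Proof.
elim: n => [|n IH]; first by rewrite /central_binomial muln0 bin0 expr0 mul1r cbin_ratio0.
rewrite -[n.+1%:R]natr1 cbin_ratioS// exprSr central_binomialS IH.
have n1 : n%:R + 1 != 0 :> R by rewrite natr1 pnatr_eq0.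
by move: (cbin_ratio _) n1; clear => *; field.
Qed.

(** Wendel ratios settle [0 <= s <= 1]; a further unit shift multiplies by
    [(t + n + 1/2) / (t + n + 1)], which tends to 1. *)
Lemma cbin_ratio_shift_cvg s : 0 <= s ->
  (fun n : nat => cbin_ratio (s + n%:R) / cbin_ratio n%:R) @ \oo --> (1 : R).
Proof.
have base t : 0 <= t <= 1 ->
    (fun n : nat => cbin_ratio (t + n%:R) / cbin_ratio n%:R) @ \oo --> (1 : R).
  move=> t01; have /andP[t0 t1] := t01.
  have c2 := @cvg_wendel_ratio R (fun n => n%:R + 2^-1) t t01 ltac:(move=> n /=; lra).
  have c3 := @cvg_wendel_ratio R (fun n => n%:R + 1) t t01 ltac:(move=> n /=; lra).
  rewrite -[X in _ --> X](_ : 1 * 1^-1 * 1 = 1 :> R); last by rewrite invr1 !mulr1.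
  apply: (@eq_cvgn _ (fun n => wendel_ratio (n%:R + 2^-1) t *
    (wendel_ratio (n%:R + 1) t)^-1 * ((n%:R + 2^-1) `^ t / (n%:R + 1) `^ t))); last first.
    by apply: cvgM; [apply: cvgM => //; exact: cvgV (oner_neq0 _) _|exact: powR_ratio_cvg1].
  move=> n.
  have n0 : 0 <= n%:R :> R by [].
  have a0 : 0 < n%:R + 2^-1 :> R by lra.
  have b0 : 0 < n%:R + 1 :> R by lra.
  rewrite /cbin_ratio.
  have -> : t + n%:R + 2^-1 = n%:R + 2^-1 + t by ring.
  have -> : t + n%:R + 1 = n%:R + 1 + t by ring.
  have G20 : 0 < Gamma (n%:R + 2^-1 : R) by exact: Gamma_gt0.
  have G30 : 0 < Gamma (n%:R + 1 : R) by exact: Gamma_gt0.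
  have G40 : 0 < Gamma (n%:R + 1 + t) by apply: Gamma_gt0; lra.
  have p4 : 0 < (n%:R + 1) `^ t by rewrite powR_gt0.
  have p3 : 0 < (n%:R + 2^-1) `^ t by rewrite powR_gt0.
  have sp := sqrt_pi_gt0.
  rewrite /wendel_ratio.
  move: (Gamma _) G20 (Gamma _) G30 (Gamma _) G40 (Gamma _) ((n%:R + 1) `^ t) p4 ((n%:R + 2^-1) `^ t) p3.
  move: (Num.sqrt pi) sp; clear => *.
  by field; rewrite !gt_eqF.
have step t : 0 <= t ->
    (fun n : nat => cbin_ratio (t + n%:R) / cbin_ratio n%:R) @ \oo --> (1 : R) ->
    (fun n : nat => cbin_ratio (t + 1 + n%:R) / cbin_ratio n%:R) @ \oo --> (1 : R).
  move=> t0 c.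
  have c1 : (fun n : nat => (t + n%:R + 2^-1) / (t + n%:R + 1)) @ \oo --> (1 : R).
    have c1 : (fun n => 1 - 2^-1 * harmonic n) @ \oo --> (1 - 2^-1 * 0 : R).
      by apply: cvgB; [exact: cvg_cst|apply: cvgMr; exact: cvg_harmonic].
    rewrite mulr0 subr0 in c1.
    apply: (squeeze_cvgr _ c1 (@cvg_cst _ (1 : R) _ \oo _)).
    apply: nearW => n /=; have n0 : 0 <= n%:R :> R by [].
    rewrite ler_pdivrMr; last by lra.
    rewrite ler_pdivlMr; last by lra.
    apply/andP; split; last by lra.
    rewrite mulrBl mul1r -mulrA.
    suff : 1 <= n.+1%:R^-1 * (t + n%:R + 1) by move: (_^-1 * _) => y ?; lra.
    by rewrite ler_pdivlMl// mulr1 -natr1; lra.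
  rewrite -[X in _ --> X](_ : 1 * 1 = 1 :> R); last by rewrite mulr1.
  apply: (eq_cvgn _ (cvgM c1 c)) => n.
  have -> : t + 1 + n%:R = t + n%:R + 1 by ring.
  by rewrite /= cbin_ratioS ?addr_ge0// -mulrA.
move=> s0; have /truncn_itv/andP[] := s0; set k := Num.trunc s => k1 k2.
rewrite -natr1 in k2.
have -> : s = (s - k%:R) + k%:R by rewrite subrK.
have r01 : 0 <= s - k%:R <= 1 by apply/andP; split; lra.
have /andP[r0 _] := r01.
move: (s - k%:R) r01 r0 {k1 k2} => r r01 r0.
elim: k => [|j IH]; first by rewrite addr0; exact: base.
rewrite -natr1 addrA; apply: step => //; exact: addr_ge0.
Qed.

Lemma cbin_ratio_shiftE s J : 0 <= s ->
  cbin_ratio (s + J%:R) =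
  cbin_ratio s * \prod_(j < J) ((s + (j%:R + 2^-1)) / (s + (j%:R + 1))).
Proof.
move=> s0; elim: J => [|J IH]; first by rewrite addr0 big_ord0 mulr1.
rewrite -natr1 addrA cbin_ratioS ?addr_ge0// IH big_ord_recr /= -!addrA; ring.
Qed.

(** By the recurrence the left-hand term equals [cbin_ratio s] times
    [cbin_ratio J / cbin_ratio (s + J)]. *)
Lemma cbin_ratio_prod_cvg s : 0 <= s ->
  (fun J : nat => cbin_ratio J%:R *
     \prod_(j < J) ((s + (j%:R + 1)) / (s + (j%:R + 2^-1)))) @ \oo --> cbin_ratio s.
Proof.
move=> s0.
rewrite -[X in _ --> X](_ : cbin_ratio s * 1^-1 = _); last by rewrite invr1 mulr1.
apply: (@eq_cvgn _ (fun n : nat => cbin_ratio s * (cbin_ratio (s + n%:R) / cbin_ratio n%:R)^-1)); last first.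
  by apply: cvgMr; apply: cvgV (oner_neq0 _) _; exact: cbin_ratio_shift_cvg.
move=> J.
rewrite cbin_ratio_shiftE// invf_div.
have -> : \prod_(j < J) ((s + (j%:R + 1)) / (s + (j%:R + 2^-1))) =
          (\prod_(j < J) ((s + (j%:R + 2^-1)) / (s + (j%:R + 1))))^-1.
  by rewrite -prodfV; apply: eq_bigr => j _; rewrite invf_div.
rewrite invfM [in RHS]mulrCA; congr (_ * _); rewrite mulrA mulfV ?mul1r//.
by rewrite gt_eqF// cbin_ratio_gt0.
Qed.

Lemma powR_exponent_cvg x (d : nat -> R) : 0 < x -> d @ \oo --> (0 : R) ->
  (fun n => x `^ d n) @ \oo --> (1 : R).
Proof.
move=> x0 d0; rewrite -(powRr0 x) /powR gt_eqF//.
apply: (continuous_cvg _ (@continuous_expR R _)).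
exact: cvgMl.
Qed.

(** Wendel's two bounds also force the ratio to 1 when [x] is fixed and the increment tends to 0. *)
Lemma Gamma_right_cvg x (d : nat -> R) : 0 < x -> (forall n, 0 <= d n <= 1) ->
  d @ \oo --> (0 : R) -> (fun n => Gamma (x + d n)) @ \oo --> Gamma x.
Proof.
move=> x0 d01 d0.
have c1 : (fun n => x / (x + d n)) @ \oo --> (x / (x + 0) : R).
  apply: cvgMr; apply: cvgV; first by rewrite addr0 gt_eqF.
  by apply: cvgD => //; exact: cvg_cst.
rewrite addr0 divff ?gt_eqF// in c1.
have c2 : (fun n => wendel_ratio x (d n)) @ \oo --> (1 : R).
  apply: (squeeze_cvgr _ c1 (@cvg_cst _ (1 : R) _ \oo _)).
  by apply: nearW => n; exact: wendel_ratio_bounds.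
rewrite -[X in _ --> X](_ : 1 * (Gamma x * 1) = _); last by rewrite mul1r mulr1.
apply: (@eq_cvgn _ (fun n => wendel_ratio x (d n) * (Gamma x * x `^ d n))).
  by move=> n; rewrite -wendel_ratioE.
by apply: cvgM => //; apply: cvgMr; exact: powR_exponent_cvg.
Qed.

Lemma cbin_ratio_right_cvg s (d : nat -> R) : 0 <= s -> (forall n, 0 <= d n <= 1) ->
  d @ \oo --> (0 : R) -> (fun n => cbin_ratio (s + d n)) @ \oo --> cbin_ratio s.
Proof.
move=> s0 d01 d0; rewrite /cbin_ratio.
have sa : 0 < s + 2^-1 by lra.
have sb : 0 < s + 1 by lra.
have ca := Gamma_right_cvg sa d01 d0; have cb := Gamma_right_cvg sb d01 d0.
under eq_fun do rewrite (addrAC s _ 2^-1) (addrAC s _ 1).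
have g0 : Num.sqrt pi * Gamma (s + 1) != 0 by rewrite gt_eqF// mulr_gt0 ?sqrt_pi_gt0// Gamma_gt0.
exact: cvgM ca (cvgV g0 (cvgMr cb)).
Qed.

End duplication.

(** * Moments of the arcsine density *)

Section arcsine.
Context {R : realType}.
Notation mu := (@lebesgue_measure R).
Implicit Types x : R.

Definition arc_root x : R := Num.sqrt (x * (4 - x)).

Lemma arc_root_gt0 x : 0 < x < 4 -> 0 < arc_root x.
Proof. by move=> /andP[x0 x4]; rewrite sqrtr_gt0 mulr_gt0// subr_gt0. Qed.

Lemma sqr_arc_root x : 0 < x < 4 -> arc_root x ^+ 2 = x * (4 - x).
Proof. by move=> /andP[x0 x4]; apply: sqr_sqrtr; rewrite ltW// mulr_gt0// subr_gt0. Qed.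

Lemma is_derive_arc_root x : 0 < x < 4 -> is_derive x 1 arc_root ((2 - x) / arc_root x).
Proof.
move=> x04; have /andP[x0 x4] := x04.
have y0 : 0 < x * (4 - x) by rewrite mulr_gt0// subr_gt0.
have d1 : is_derive x 1 (fun y : R => y * (4 - y)) (4 - 2 * x).
  by apply: is_derive_eq; rewrite /GRing.scale /=; ring.
have d2 := is_derive1_sqrt y0.
have d := @is_derive1_comp R (@Num.sqrt R) (fun y : R => y * (4 - y)) x _ _ d2 d1.
apply: (is_derive_eq d).
have w0 := arc_root_gt0 x04; rewrite -/(arc_root x).
by move: (arc_root x) w0; clear => v v0; field; rewrite gt_eqF.
Qed.

Lemma is_derive_exprn n x : is_derive x 1 (fun y : R => y ^+ n) (n%:R * x ^+ n.-1).
Proof.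
case: n => [|n]; first by rewrite mul0r; exact: is_derive_cst.
apply: DeriveDef; first exact: exprn_derivable.
by rewrite exp_derive /GRing.scale /= mulr1.
Qed.

(** Once integrated, with boundary terms vanishing at 0 and 4, this is the recurrence
    [central_binomialS]. *)
Lemma is_derive_arcsine_moment n x : 0 < x < 4 ->
  is_derive x 1 (fun y => y ^+ n * arc_root y)
    ((4 * n%:R + 2) * (x ^+ n / arc_root x) - (n%:R + 1) * (x ^+ n.+1 / arc_root x)).
Proof.
move=> x04; have dw := is_derive_arc_root x04; have w0 := arc_root_gt0 x04.
have dx := is_derive_exprn n x.
have d := is_deriveM dx dw; apply: (is_derive_eq d); rewrite /GRing.scale /=.
have -> : arc_root x * (n%:R * x ^+ n.-1) = n%:R * x ^+ n.-1 * (arc_root x ^+ 2 / arc_root x).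
  by move: (arc_root x) w0; clear => v v0; field; rewrite gt_eqF.
rewrite sqr_arc_root// exprS.
have -> : n%:R * x ^+ n.-1 * (x * (4 - x) / arc_root x) = n%:R * x ^+ n * ((4 - x) / arc_root x).
  case: (n) => [|m]; first by rewrite !mul0r.
  by rewrite /= exprS; ring.
by move: (arc_root x) w0; clear => v v0; field; rewrite gt_eqF.
Qed.

Lemma is_derive_acos_shift x : 0 < x < 4 ->
  is_derive x 1 (fun y => - acos ((y - 2) / 2)) (x ^+ 0 / arc_root x).
Proof.
move=> x04; have /andP[x0 x4] := x04.
have z1 : -1 < (x - 2) / 2 < 1 by apply/andP; split; lra.
have d1 : is_derive x 1 (fun y : R => (y - 2) / 2) (2^-1).
  by apply: is_derive_eq; rewrite /GRing.scale /=; ring.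
have d2 := is_derive1_acos z1.
have d3 := @is_derive1_comp R (@acos R) (fun y : R => (y - 2) / 2) x _ _ d2 d1.
have d4 := is_deriveN d3.
apply: (is_derive_eq d4); rewrite expr0 mul1r mulNr opprK.
have -> : 1 - ((x - 2) / 2) ^+ 2 = x * (4 - x) / 2 ^+ 2 by field.
rewrite sqrtrM; last by rewrite ltW// mulr_gt0// subr_gt0.
by rewrite -exprVn sqrtr_sqr ger0_norm ?invr_ge0// -/(arc_root x) invfM invrK mulfK.
Qed.

Definition arc_angle (i : nat) : R := i.+1%:R^-1.

Lemma arc_angle_bnd i : 0 < arc_angle i <= 1.
Proof. by rewrite invr_gt0 ltr0n/= invf_le1// ler1n. Qed.

Lemma arc_angle_pi i : arc_angle i \in `[0, pi].
Proof.
have /andP[d0 d1] := arc_angle_bnd i; rewrite in_itv/= ltW//=.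
by rewrite (le_trans d1)// (le_trans _ (pi_ge2 R))// ler1n.
Qed.

Lemma cos_arc_angle i : 0 < cos (arc_angle i) < 1.
Proof.
have /andP[d0 d1] := arc_angle_bnd i; apply/andP; split.
  apply: cos_gt0_pihalf; have p1 := @pihalf_ge1 R.
  have p2 : 2 <= pi :> R := @pi_ge2 R.
  have [d1'|d1'] := ltP (arc_angle i) (pi / 2); first by rewrite andbT; lra.
  exfalso; have := @cos1_gt0 R.
  have -> : 1 = pi / 2 :> R by lra.
  by rewrite cos_pihalf ltxx.
by rewrite -(@cos0 R) ltr_cos ?arc_angle_pi// in_itv/= lexx pi_ge0.
Qed.

(** The parametrisation [x = 2 + 2 cos(theta)] gives [arc_root] and [acos] closed values at both
    ends, so the boundary terms are explicit and vanish with the angle, while the singularities 0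
    and 4 stay outside. *)
Definition arc_lo i : R := 2 - 2 * cos (arc_angle i).
Definition arc_hi i : R := 2 + 2 * cos (arc_angle i).

Lemma arc_lo_hi i x : arc_lo i <= x <= arc_hi i -> 0 < x < 4.
Proof.
have /andP[c0 c1] := cos_arc_angle i; rewrite /arc_lo /arc_hi => /andP[? ?].
by apply/andP; split; lra.
Qed.

Lemma arc_lo_lt_hi i : arc_lo i < arc_hi i.
Proof. by have /andP[c0 c1] := cos_arc_angle i; rewrite /arc_lo /arc_hi; lra. Qed.

Lemma bigcup_arc_lo_hi : \bigcup_i `[arc_lo i, arc_hi i]%classic = `]0, 4[%classic.
Proof.
apply/seteqP; split=> [x [i _]|x] /=; rewrite !in_itv/=; first exact: arc_lo_hi.
move=> /andP[x0 x4].
have c : (fun i => cos (arc_angle i)) @ \oo --> (1 : R).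
  rewrite -(@cos0 R); apply: continuous_cvg; first exact: continuous_cos.
  exact: cvg_harmonic.
have m1 : 0 < 1 - `|x - 2| / 2.
  by rewrite subr_gt0 ltr_pdivrMr// mul1r ltr_norml; apply/andP; split; lra.
have /cvgrPdist_lt/(_ _ m1) [N _ /(_ N (leqnn _))] /= := c.
move=> h; exists N => //=; rewrite in_itv/= /arc_lo /arc_hi.
have {h} := le_lt_trans (ler_norm _) h.
have := ler_norm (x - 2); have := ler_norm (- (x - 2)); rewrite normrN.
by move: `|x - 2| (cos _) => u v ? ? ?; apply/andP; split; lra.
Qed.

Definition arc_term n x : R := x ^+ n / arc_root x.

Lemma arc_term_ge0 n i x : arc_lo i <= x <= arc_hi i -> 0 <= arc_term n x.
Proof.
move=> /arc_lo_hi x04; have /andP[x0 _] := x04.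
by rewrite divr_ge0 ?exprn_ge0// ltW// arc_root_gt0.
Qed.

Lemma measurable_arc_rootV : measurable_fun (`]0, 4[%classic : set R) (fun x => (arc_root x)^-1).
Proof.
apply: (eq_measurable_fun (fun x => (x * (4 - x)) `^ (- 2^-1))).
  move=> x; rewrite inE/= in_itv/= => /andP[x0 x4].
  by rewrite powRN powR12_sqrt// ltW// mulr_gt0// subr_gt0.
apply: measurable_funTS.
apply: (@measurableT_comp _ _ _ _ _ _ (fun y : R => y `^ (- 2^-1))); first exact: measurable_powR.
by apply: measurable_funM => //; exact: measurable_funB.
Qed.

Lemma measurable_arc_term n : measurable_fun (`]0, 4[%classic : set R) (arc_term n).
Proof.
apply: measurable_funM; last exact: measurable_arc_rootV.
by apply: measurable_funTS; exact: exprn_measurable.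
Qed.

Lemma continuous_arc_term n i : {within `[arc_lo i, arc_hi i], continuous (arc_term n)}.
Proof.
apply: derivable_within_continuous => x; rewrite in_itv/= => /arc_lo_hi x04.
have dw := is_derive_arc_root x04; have w0 := arc_root_gt0 x04.
have dx : derivable (fun y : R => y ^+ n) x 1 by exact: exprn_derivable.
have [dw' _] := dw.
apply: (derivableM dx); apply: derivableV => //; exact: lt0r_neq0.
Qed.

Definition arc_trunc n i : R := \int[mu]_(x in `[arc_lo i, arc_hi i]) arc_term n x.

Lemma arc_trunc0 i : arc_trunc 0 i = pi - 2 * arc_angle i.
Proof.
have -> : arc_trunc 0 i = - acos ((arc_hi i - 2) / 2) - - acos ((arc_lo i - 2) / 2).
  apply: (@FTC_is_derive R (fun y => - acos ((y - 2) / 2))); first exact: arc_lo_lt_hi.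
    by move=> x /arc_lo_hi; exact: is_derive_acos_shift.
  exact: (@continuous_arc_term 0%N).
have -> : (arc_hi i - 2) / 2 = cos (arc_angle i) by rewrite /arc_hi; field.
  have -> : (arc_lo i - 2) / 2 = - cos (arc_angle i) by rewrite /arc_lo; field.
  have /andP[c0 c1] := cos_arc_angle i.
  rewrite acosN; last by apply/andP; split; lra.
  by rewrite cosK ?arc_angle_pi//; ring.
Qed.

Lemma arc_root_ends i : arc_root (arc_hi i) = 2 * sin (arc_angle i) /\ arc_root (arc_lo i) = 2 * sin (arc_angle i).
Proof.
have s0 : 0 <= 2 * sin (arc_angle i).
  by rewrite mulr_ge0// sin_ge0_pi//; have := arc_angle_pi i; rewrite in_itv.
have E : (2 - 2 * cos (arc_angle i)) * (2 + 2 * cos (arc_angle i)) = (2 * sin (arc_angle i)) ^+ 2.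
  by rewrite exprMn sin2cos2; ring.
rewrite /arc_root /arc_hi /arc_lo; split.
  have -> : (2 + 2 * cos (arc_angle i)) * (4 - (2 + 2 * cos (arc_angle i))) = (2 * sin (arc_angle i)) ^+ 2 by rewrite -E; ring.
  by rewrite sqrtr_sqr ger0_norm.
have -> : (2 - 2 * cos (arc_angle i)) * (4 - (2 - 2 * cos (arc_angle i))) = (2 * sin (arc_angle i)) ^+ 2 by rewrite -E; ring.
by rewrite sqrtr_sqr ger0_norm.
Qed.

Lemma arc_truncS n i : arc_trunc n.+1 i = (4 * n%:R + 2) / (n%:R + 1) * arc_trunc n i
  - (n%:R + 1)^-1 * ((arc_hi i ^+ n - arc_lo i ^+ n) * (2 * sin (arc_angle i))).
Proof.
have ig m : mu.-integrable `[arc_lo i, arc_hi i] (EFin \o arc_term m).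
  by apply: segment_integrable; exact: continuous_arc_term.
have iz c m : mu.-integrable `[arc_lo i, arc_hi i] (EFin \o (fun x => c * arc_term m x)).
  rewrite (_ : EFin \o _ = fun x => (c%:E * (arc_term m x)%:E)%E).
    by apply: integrableZl => //; exact: ig.
  by apply/funext => x; rewrite /= EFinM.
have n1 : n%:R + 1 != 0 :> R by rewrite natr1 pnatr_eq0.
suff E : (4 * n%:R + 2) * arc_trunc n i - (n%:R + 1) * arc_trunc n.+1 i =
    (arc_hi i ^+ n - arc_lo i ^+ n) * (2 * sin (arc_angle i)).
  by rewrite -E; move: (arc_trunc _ _) (arc_trunc _ _) n1; clear => *; field.
have -> : (arc_hi i ^+ n - arc_lo i ^+ n) * (2 * sin (arc_angle i)) = arc_hi i ^+ n * arc_root (arc_hi i) - arc_lo i ^+ n * arc_root (arc_lo i).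
  by have [-> ->] := arc_root_ends i; rewrite mulrBl.
rewrite /arc_trunc -!RintegralZl// -RintegralB//.
apply: (@FTC_is_derive R (fun y => y ^+ n * arc_root y)).
- exact: arc_lo_lt_hi.
- by move=> x /arc_lo_hi x04; exact: is_derive_arcsine_moment.
- by move=> x; apply: cvgB; apply: cvgMr; exact: continuous_arc_term.
Qed.

Lemma arc_trunc_cvg n : arc_trunc n @ \oo --> (pi * central_binomial R n : R).
Proof.
have dl0 : arc_angle @ \oo --> (0 : R) by exact: cvg_harmonic.
elim: n => [|n IH].
  have -> : pi * central_binomial R 0 = pi - 2 * 0 :> R.
    by rewrite /central_binomial muln0 bin0 mulr1 mulr0 subr0.
  apply: (@eq_cvgn _ _ (fun i => pi - 2 * arc_angle i)); first exact: arc_trunc0.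
  by apply: cvgB; [exact: cvg_cst|exact: cvgMr].
have -> : pi * central_binomial R n.+1 = (4 * n%:R + 2) / (n%:R + 1) * (pi * central_binomial R n)
    - (n%:R + 1)^-1 * ((4 ^+ n - 0 ^+ n) * (2 * 0)).
  by rewrite !mulr0 subr0 central_binomialS; ring.
apply: (eq_cvgn (arc_truncS n)).
have cc : (fun i => cos (arc_angle i)) @ \oo --> (1 : R).
  by rewrite -(@cos0 R); apply: continuous_cvg => //; exact: continuous_cos.
have cs : (fun i => sin (arc_angle i)) @ \oo --> (0 : R).
  by rewrite -(@sin0 R); apply: continuous_cvg => //; exact: continuous_sin.
have ch : arc_hi @ \oo --> (4 : R).
  rewrite (_ : 4 = 2 + 2 * 1); last by ring.
  by apply: cvgD; [exact: cvg_cst|exact: cvgMr].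
have cl : arc_lo @ \oo --> (0 : R).
  rewrite (_ : 0 = 2 - 2 * 1 :> R); last by ring.
  by apply: cvgB; [exact: cvg_cst|exact: cvgMr].
apply: cvgB; first exact: cvgMr.
apply: cvgMr; apply: cvgM; last exact: cvgMr.
by apply: cvgB; apply: (continuous_cvg _ (@exprn_continuous _ n _)).
Qed.

Definition arcsine_pdf x : R :=
  if (0 < x) && (x < 4) then pi^-1 * (Num.sqrt (x * (4 - x)))^-1 else 0.

Lemma arcsine_pdf_ge0 x : 0 <= arcsine_pdf x.
Proof.
rewrite /arcsine_pdf; case: ifPn => // _.
by rewrite mulr_ge0 ?invr_ge0 ?sqrtr_ge0 ?pi_ge0.
Qed.

Lemma measurable_arcsine_pdf : measurable_fun setT arcsine_pdf.
Proof.
apply: measurable_fun_if => //.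
- by apply: measurable_and => //; exact: measurable_fun_ltr.
- rewrite setTI; apply: measurable_funM => //.
  apply: measurable_funS measurable_arc_rootV => // x /=; by rewrite in_itv/=.
Qed.

Lemma arcsine_moment n :
  (\int[mu]_(x in `]0%R, 4%R[) (x ^+ n * arcsine_pdf x)%:E = (central_binomial R n)%:E)%E.
Proof.
have c1 : (fun i => (arc_trunc n i)%:E) @ \oo --> (pi * central_binomial R n)%:E.
  by apply/cvg_EFin; [exact: nearW|exact: arc_trunc_cvg].
have c2 : (fun i => (arc_trunc n i)%:E) @ \oo --> (\int[mu]_(x in `]0%R, 4%R[) (arc_term n x)%:E)%E.
  rewrite -bigcup_arc_lo_hi.
  rewrite (_ : (fun i => _) = fun i => (\int[mu]_(x in `[arc_lo i, arc_hi i]) (arc_term n x)%:E)%E); last first.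
    apply/funext => i; rewrite /arc_trunc /Rintegral fineK//; apply: integrable_fin_num => //.
    by apply: segment_integrable; exact: continuous_arc_term.
  apply: ge0_nondecreasing_set_cvg_integral => //.
  - apply/nondecreasing_seqP => i; rewrite subsetEset => x /=; rewrite !in_itv/= /arc_lo /arc_hi.
    have : cos (arc_angle i) <= cos (arc_angle i.+1).
      by rewrite ltW// ltr_cos ?arc_angle_pi// ltf_pV2 ?posrE// ltr_nat.
    by move: (cos _) (cos _); clear => ? ? ? /andP[? ?]; apply/andP; split; lra.
  - move=> i; apply/measurable_EFinP; apply: measurable_funS (measurable_arc_term n) => // x /=.
    by rewrite !in_itv/=; exact: arc_lo_hi.
  - by move=> i x /=; rewrite in_itv/= lee_fin; exact: arc_term_ge0.
have E : (\int[mu]_(x in `]0%R, 4%R[) (arc_term n x)%:E = (pi * central_binomial R n)%:E)%E.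
  exact: (cvg_unique _ c2 c1).
have pi0 : 0 <= (pi : R)^-1 by rewrite invr_ge0 pi_ge0.
transitivity (\int[mu]_(x in `]0%R, 4%R[) ((pi^-1)%:E * (arc_term n x)%:E))%E.
  apply: eq_integral => x; rewrite inE/= in_itv/= => x04.
  by rewrite /arcsine_pdf x04 -EFinM /arc_term /arc_root mulrCA.
rewrite ge0_integralZl_EFin//; last 2 first.
- move=> x /=; rewrite in_itv/= => x04; rewrite lee_fin divr_ge0//; last by rewrite ltW// arc_root_gt0.
  by case/andP: x04 => x0 _; rewrite exprn_ge0// ltW.
- by apply/measurable_EFinP; exact: measurable_arc_term.
by rewrite E -EFinM mulrA mulVf ?mul1r// gt_eqF// pi_gt0.
Qed.

End arcsine.

Lemma integral_null_setC (R : realType) (d : measure_display)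
    (T : measurableType d) (mu : {measure set T -> \bar R}) (D : set T)
    (f : T -> \bar R) :
  measurable D -> mu (~` D) = 0%E -> measurable_fun setT f ->
  (\int[mu]_x f x = \int[mu]_(x in D) f x)%E.
Proof.
move=> mD D0 mf; rewrite -(setUv D) integral_setU//=.
- rewrite [X in (_ + X)%E]null_set_integral ?adde0//; first exact: measurableC.
  exact: measurable_funTS.
- exact: measurableC.
- by rewrite setUv.
- exact/disj_setPCl.
Qed.

(** * Identification of the law for c = 1 *)

Section arcsine_law.
Context {R : realType}.
Notation mu := (@lebesgue_measure R).

Lemma central_binomial_le n : central_binomial R n <= 4 ^+ n.
Proof.
elim: n => [|n IH]; first by rewrite /central_binomial muln0 bin0 expr0.
rewrite central_binomialS exprS; apply: ler_pM => //.
by rewrite ler_pdivrMr ?ltr_wpDl//; have : 0 <= n%:R :> R by []; lra.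
Qed.

Definition arcsine_prob (A : set (measurableTypeR R)) : \bar R :=
  (\int[mu]_(x in A) (arcsine_pdf x)%:E)%E.

Let arcsine_prob0 : arcsine_prob set0 = 0%E.
Proof. by rewrite /arcsine_prob integral_set0. Qed.

Let arcsine_prob_ge0 A : (0 <= arcsine_prob A)%E.
Proof. by apply: integral_ge0 => x _; rewrite lee_fin arcsine_pdf_ge0. Qed.

Let mpdf A : measurable_fun (A : set R) (fun x => (@arcsine_pdf R x)%:E).
Proof. by apply/measurable_EFinP/measurable_funTS; exact: measurable_arcsine_pdf. Qed.

Let arcsine_prob_sigma_additive : semi_sigma_additive arcsine_prob.
Proof.
move=> F mF tF mUF; rewrite /arcsine_prob ge0_integral_bigcup//.
- apply: is_cvg_nneseries => n _ _.
  by apply: integral_ge0 => x _; rewrite lee_fin arcsine_pdf_ge0.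
- exact: mpdf.
- by move=> x _; rewrite lee_fin arcsine_pdf_ge0.
Qed.

HB.instance Definition _ := isMeasure.Build _ _ _ arcsine_prob
  arcsine_prob0 arcsine_prob_ge0 arcsine_prob_sigma_additive.

Let arcsine_prob_support : arcsine_prob (~` `]0, 4[%classic) = 0%E.
Proof.
apply: integral0_eq => x /=; rewrite in_itv/= => /negP/negbTE x04.
by rewrite /arcsine_pdf x04.
Qed.

Let arcsine_prob_setT : arcsine_prob setT = 1%E.
Proof.
rewrite /arcsine_prob -(setUv `]0, 4[%classic) ge0_integral_setU//=.
- rewrite -[X in (_ + X)%E]/(arcsine_prob _) arcsine_prob_support adde0.
  have := @arcsine_moment R 0; rewrite /central_binomial muln0 bin0 => <-.
  by apply: eq_integral => x _; rewrite expr0 mul1r.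
- exact: measurableC.
- exact: mpdf.
- by move=> x _; rewrite lee_fin arcsine_pdf_ge0.
- exact/disj_setPCl.
Qed.

HB.instance Definition _ := @Measure_isProbability.Build _ _ R
  arcsine_prob arcsine_prob_setT.

(** The density agrees almost everywhere with the Radon-Nikodym derivative of [arcsine_prob], which
    reduces the integral to a Lebesgue integral. *)
Lemma arcsine_prob_moment n :
  (\int[arcsine_prob]_x (x ^+ n)%:E = (central_binomial R n)%:E)%E.
Proof.
pose D : set R := `]0, 4[%classic.
have mD : measurable D by exact: measurable_itv.
have mX (A : set R) : measurable_fun A (fun x : R => (x ^+ n)%:E).
  by apply/measurable_EFinP/measurable_funTS; exact: exprn_measurable.
have dom : arcsine_prob `<< mu.
  apply/null_content_dominatesP => A mA A0; by apply: null_set_integral => //; exact: mpdf.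
have -> : (\int[arcsine_prob]_x (x ^+ n)%:E = \int[arcsine_prob]_(x in D) (x ^+ n)%:E)%E.
  apply: (@integral_null_setC R _ (measurableTypeR R) _ D _ mD); [exact: arcsine_prob_support|exact: mX].
have iX : arcsine_prob.-integrable D (fun x => (x ^+ n)%:E).
  apply: (@bounded_integrable R _ (measurableTypeR R) arcsine_prob D
    (fun x => (x : R) ^+ n) (4 ^+ n)) => //.
  - by apply: (le_lt_trans (@probability_le1 _ _ _ arcsine_prob _ mD)); rewrite ltry.
  - move=> x; rewrite /D /= in_itv/= => /andP[x0 x4].
    by rewrite normrX (gtr0_norm x0) lerXn2r ?nnegrE ?ltW.
rewrite -(Radon_Nikodym_change_of_variables dom mD iX) -arcsine_moment.
under [RHS]eq_integral do rewrite EFinM.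
apply: ae_eq_integral => //.
- apply: emeasurable_funM; first exact: mX.
  apply: (measurable_int mu).
  apply: (integrableS _ _ (@subsetT _ _)) => //=.
  by apply: Radon_Nikodym_integrable; exact: dom.
- by apply: emeasurable_funM; [exact: mX|exact: mpdf].
- apply: ae_eqe_mul2l => /=.
  rewrite Radon_NikodymE//=.
  case: cid => /= h [h1 h2 h3].
  apply: integral_ae_eq => //=.
  + exact: integrableS h2.
  + exact: mpdf.
  + by move=> E ED mE; rewrite -h3.
Qed.

(** A random variable may a priori take negative values, so determinacy is applied on the whole
    line, with [K = 4]. *)
Lemma arcsine_law (nu : {measure set (measurableTypeR R) -> \bar R}) :
  (forall n, \int[nu]_x (x ^+ n)%:E = (central_binomial R n)%:E)%E ->
  forall A, measurable A -> nu A = (\int[mu]_(x in A) (arcsine_pdf x)%:E)%E.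
Proof.
move=> hnu A mA.
apply: (@moment_determinacy R nu arcsine_prob (central_binomial R) 4) => //.
- by move=> n; exact: central_binomial_le.
- exact: arcsine_prob_moment.
Qed.

End arcsine_law.

(** * The moments centred at 2 *)

Section shifted_moments.
Context {R : realType}.

Lemma coef_1DX_exp n i : ((1 + 'X : {poly R}) ^+ n)`_i = 'C(n, i)%:R.
Proof.
rewrite exprDn coef_sum.
under eq_bigr do rewrite expr1n mul1r coefMn coefXn.
have [iN|Ni] := ltnP i n.+1.
  rewrite (bigD1 (Ordinal iN))//= eqxx big1 ?addr0// => j ji.
  rewrite eq_sym; case: eqP => [ij|]; last by rewrite mul0rn.
  by move: ji; rewrite -val_eqE /= ij eqxx.
rewrite bin_small// big1// => j _; case: eqP => [ij|]; last by rewrite mul0rn.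
by move: (ltn_ord j); rewrite -ij ltnNge Ni.
Qed.

Lemma coef_1DX2_exp m :
  ((1 + 'X^2 : {poly R}) ^+ m)`_m = if odd m then 0 else 'C(m, m./2)%:R.
Proof.
rewrite exprDn coef_sum.
under eq_bigr do rewrite expr1n mul1r coefMn -exprM coefXn.
case: ifPn => om.
  rewrite big1// => j _; case: eqP => [ij|]; last by rewrite mul0rn.
  by have := congr1 odd ij; rewrite oddM om.
have me : (m = 2 * m./2)%N by rewrite mul2n even_halfK.
have mm : (m./2 < m.+1)%N by lia.
rewrite (bigD1 (Ordinal mm))//= -me eqxx big1 ?addr0// => j ji.
case: eqP => [ij|]; last by rewrite mul0rn.
by move: ji; rewrite -val_eqE /= => /eqP; lia.
Qed.

(* Coefficient of [X^m] in [((1 + X)^2 - 2 X)^m = (1 + X^2)^m]. *)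
Lemma sum_central_binomial_shift m :
  \sum_(i < m.+1) (-2) ^+ (m - i) * central_binomial R i *+ 'C(m, i) =
  if odd m then 0 else 'C(m, m./2)%:R.
Proof.
rewrite -coef_1DX2_exp.
have -> : 1 + 'X^2 = (-2)%:P * 'X + (1 + 'X) ^+ 2 :> {poly R}.
  by rewrite rmorphN /= polyC_natr; ring.
rewrite [in RHS]exprDn coef_sum; apply: eq_bigr => i _.
rewrite coefMn exprMn -exprM -mulrA -rmorphXn /= coefCM coefXnM.
have im : (i <= m)%N by have := ltn_ord i; lia.
have -> : (m < m - i)%N = false by lia.
have -> : (m - (m - i) = i)%N by lia.
by rewrite coef_1DX_exp.
Qed.

End shifted_moments.

(** * Expansion of exponential moments for bounded support *)

Section exponential_moments.
Context {R : realType}.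
Variables (mu : {measure set (measurableTypeR R) -> \bar R}) (m : nat -> R) (K : R).
Hypothesis mom : forall n, (\int[mu]_x (x ^+ n)%:E = (m n)%:E)%E.
Hypothesis K0 : 0 <= K.
Hypothesis mK : forall n, m (2 * n)%N <= K ^+ (2 * n).
Variable (L : R).
Hypothesis KL : K < L.
Notation D := (`[- L, L]%classic : set R).

Lemma sum_exp_le (y : R) N : \sum_(k < N) `|y| ^+ k / k`!%:R <= expR `|y|.
Proof.
have c := is_cvg_series_exp_coeff `|y|.
have nd : nondecreasing_seq (series (exp_coeff `|y|)).
  apply/nondecreasing_seqP => n; rewrite seriesSr lerDl /exp_coeff /=.
  by rewrite divr_ge0// exprn_ge0.
have := nondecreasing_cvgn_le nd c N; rewrite /series /= big_mkord.
by apply: le_trans; rewrite le_eqVlt; apply/orP; left; apply/eqP/eq_bigr.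
Qed.

Lemma shift_segment_bound (a x : R) : D x -> `|x - a| <= L + `|a|.
Proof.
rewrite /= in_itv/= -ler_norml => xL; apply: le_trans (ler_normB _ _) _.
by rewrite lerD2r.
Qed.

Lemma exp_moment_integrable (a t : R) :
  mu.-integrable D (EFin \o (fun x => expR (t * (x - a)))).
Proof.
have mD : measurable D by exact: measurable_itv.
apply: (@bounded_integrable R _ _ _ _ _ (expR (`|t| * (L + `|a|)))) => //.
- exact: (moment_finite mom mD).
- apply: measurable_funTS; apply: measurableT_comp => //.
  by apply: measurable_funM => //; exact: measurable_funB.
- move=> x Dx; rewrite ger0_norm ?expR_ge0// ler_expR (le_trans (ler_norm _))// normrM.
  by rewrite ler_wpM2l// shift_segment_bound.
Qed.

(** Dominated convergence on a segment, under a constant. The centre is left free: 0 yields the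
    moment series, 2 the Bessel series. *)
Lemma exp_moment_series (a t : R) :
  (fun N => \sum_(k < N) (t ^+ k / k`!%:R * \int[mu]_(x in `[- L, L]) ((x - a) ^+ k))) @ \oo
  --> \int[mu]_(x in `[- L, L]) expR (t * (x - a)).
Proof.
have mD : measurable D by exact: measurable_itv.
have fin := moment_finite mom mD.
have Dbnd := @shift_segment_bound a.
have iexp := exp_moment_integrable a t.
have mpow k : measurable_fun setT (fun x : R => (x - a) ^+ k).
  apply: (@measurableT_comp _ _ _ _ _ _ (fun y : R => y ^+ k)); first exact: exprn_measurable.
  exact: measurable_funB.
have ipow k (c : R) : mu.-integrable D (EFin \o (fun x => c * (x - a) ^+ k)).
  apply: (@bounded_integrable R _ _ _ _ _ (`|c| * (L + `|a|) ^+ k)) => //.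
    by apply: measurable_funTS; apply: measurable_funM; [exact: measurable_cst|exact: mpow].
  move=> x Dx; rewrite normrM ler_wpM2l// normrX lerXn2r ?nnegrE ?Dbnd//.
  by rewrite (le_trans _ (Dbnd x Dx)).
pose S N x : R := \sum_(k < N) t ^+ k / k`!%:R * (x - a) ^+ k.
have SE N : \sum_(k < N) (t ^+ k / k`!%:R * \int[mu]_(x in D) ((x - a) ^+ k)) =
    \int[mu]_(x in D) S N x.
  rewrite /S (@Rintegral_sum _ _ (measurableTypeR R) mu D N (fun k x => t ^+ k / k`!%:R * (x - a) ^+ k))//.
  apply: eq_bigr => k _; rewrite RintegralZl//.
  rewrite (_ : (fun x => (x - a) ^+ k) = fun x => 1 * (x - a) ^+ k); first exact: ipow.
  by apply/funext => x; rewrite mul1r.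
apply: (eq_cvgn SE).
apply: fine_cvg; rewrite fineK; last exact: integrable_fin_num.
apply: (@dominated_cvg _ _ _ mu D mD _ _ (fun=> (expR (`|t| * (L + `|a|)))%:E)) => //.
- move=> N; apply/measurable_EFinP.
  have := @integrable_Rsum _ _ (measurableTypeR R) mu D N (fun k x => t ^+ k / k`!%:R * (x - a) ^+ k) mD.
  by move=> /(_ (fun k => ipow k _)) /measurable_int/measurable_EFinP.
- move=> x Dx; apply/cvg_EFin; first exact: nearW.
  have := is_cvg_series_exp_coeff (t * (x - a)); rewrite -/(expR _).
  apply: cvg_trans; apply: near_eq_cvg; apply: nearW => N /=.
  rewrite /series /= big_mkord /S; apply: eq_bigr => k _.
  by rewrite /exp_coeff /= exprMn; ring.
- apply: (@bounded_integrable R _ _ _ _ (cst _) `|expR (`|t| * (L + `|a|))|) => //.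
- move=> N x Dx; rewrite /= lee_fin /S.
  apply: le_trans (ler_norm_sum _ _ _) _.
  apply: (@le_trans _ _ (expR `|t * (x - a)|)).
    apply: le_trans (sum_exp_le _ N); rewrite le_eqVlt; apply/orP; left; apply/eqP.
    apply: eq_bigr => k _; rewrite !normrM normrX normfV normr_nat exprMn normrX; ring.
  by rewrite ler_expR normrM ler_wpM2l// Dbnd.
Qed.

Lemma exp_moment_truncated t :
  (\int[mu]_x (expR (t * x))%:E = (\int[mu]_(x in `[- L, L]) expR (t * x))%:E)%E.
Proof.
have mD : measurable D by exact: measurable_itv.
have mexp (A : set R) : measurable_fun A (fun x : R => (expR (t * x))%:E).
  apply/measurable_EFinP/measurable_funTS; exact: measurableT_comp.
rewrite (@integral_null_setC R _ (measurableTypeR R) mu D _ mD (moment_tail mom K0 mK KL) (mexp _)).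
rewrite /Rintegral fineK//; apply: integrable_fin_num => //.
rewrite (_ : (fun x => _) = EFin \o (fun x => expR (t * (x - 0)))).
  exact: exp_moment_integrable.
by apply/funext => x /=; rewrite subr0.
Qed.

Lemma shifted_moment (a : R) k :
  \int[mu]_(x in `[- L, L]) ((x - a) ^+ k) =
  \sum_(i < k.+1) (- a) ^+ (k - i) * m i *+ 'C(k, i).
Proof.
have mD : measurable D by exact: measurable_itv.
under eq_Rintegral => x _.
  rewrite addrC exprDn.
  under eq_bigr do rewrite -mulr_natr mulrAC.
  over.
have iX i : mu.-integrable D (EFin \o (fun x => x ^+ i)) by exact: (moment_integrable mom).
rewrite (@Rintegral_sum _ _ (measurableTypeR R) mu D k.+1 (fun i x => (- a) ^+ (k - i) * 'C(k, i)%:R * x ^+ i))//.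
  apply: eq_bigr => i _; rewrite RintegralZl// (moment_truncated mom K0 mK)//.
  by rewrite mulrAC mulr_natr.
move=> i; rewrite (_ : EFin \o _ = fun x => (((- a) ^+ (k - i) * 'C(k, i)%:R)%:E * (x ^+ i)%:E)%E).
  by apply: integrableZl => //; exact: iX.
by apply/funext => x; rewrite /= EFinM.
Qed.

End exponential_moments.

(** * The measures with moments [B_n^c] and their Mellin transforms *)

Section power_laws.
Context {R : realType}.
Notation leb := (@lebesgue_measure R).

Lemma powR_base_cvg (u : nat -> R) (l c : R) : 0 < l -> (forall n, 0 < u n) ->
  u @ \oo --> l -> (fun n => u n `^ c) @ \oo --> l `^ c.
Proof.
move=> l0 u0 ul; rewrite /powR (gt_eqF l0).
apply: (@eq_cvgn _ _ (fun n => expR (c * ln (u n)))).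
  by move=> n; rewrite (gt_eqF (u0 n)).
apply: (continuous_cvg _ (@continuous_expR R _)); apply: cvgMr.
exact: (continuous_cvg _ (continuous_ln l0)).
Qed.

Lemma completely_monotone_cbin_ratio_powR (h c : R) : 0 < h -> 0 < c ->
  completely_monotone (fun n => cbin_ratio (n%:R * h) `^ c).
Proof.
move=> h0 c0.
pose r n J : R := \prod_(j < J) ((n%:R * h + (j%:R + 1)) / (n%:R * h + (j%:R + 2^-1))).
have nh n : 0 <= n%:R * h by rewrite mulr_ge0// ltW.
have rpos n (j : nat) : 0 < (n%:R * h + (j%:R + 1)) / (n%:R * h + (j%:R + 2^-1)).
  by rewrite divr_gt0// ltr_wpDl// ltr_wpDl.
have r0 n J : 0 < r n J by apply: prodr_gt0 => j _; exact: rpos.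
apply: (@completely_monotone_lim _ (fun J n => (cbin_ratio J%:R * r n J) `^ c)); last first.
  move=> n; apply: powR_base_cvg; [exact: cbin_ratio_gt0| |exact: cbin_ratio_prod_cvg].
  by move=> J; rewrite mulr_gt0// cbin_ratio_gt0.
move=> J.
have -> : (fun n => (cbin_ratio J%:R * r n J) `^ c) = (fun n => cbin_ratio J%:R `^ c *
    expR (c * \sum_(j < J) ln ((n%:R * h + (j%:R + 1)) / (n%:R * h + (j%:R + 2^-1))))).
  apply/funext => n; rewrite powRM ?(ltW (r0 _ _)) ?ltW ?cbin_ratio_gt0//.
  congr (_ * _); rewrite /powR gt_eqF//; congr (expR (c * _)).
  rewrite /r; elim: J => [|J IH]; first by rewrite !big_ord0 ln1.
  by rewrite !big_ord_recr /= lnM ?posrE ?rpos ?prodr_gt0// IH.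
apply: completely_monotoneZ; first exact: powR_ge0.
apply: completely_monotone_expR; apply: completely_monotoneZ; first exact: ltW.
apply: (@completely_monotone_sum _ J (fun j n =>
  ln ((n%:R * h + (j%:R + 1)) / (n%:R * h + (j%:R + 2^-1))))) => j.
apply: (completely_monotone_ln_ratio h0); first by rewrite ltr_wpDl.
by rewrite ltrD2l; lra.
Qed.

Lemma setC_itv_nneg : ~` `[0%R, +oo[%classic = `]-oo, 0%R[%classic :> set R.
Proof. by rewrite setCitvr. Qed.

Lemma central_binomial_powR_E (c : R) n :
  (2 `^ (2 * n%:R) * cbin_ratio n%:R) `^ c = central_binomial R n `^ c.
Proof.
rewrite central_binomialE -natrM powR_mulrn// exprM; congr ((_ ^+ _ * _) `^ _).
by rewrite -natrX.
Qed.

Lemma cbin_ratio_powR_split (c t : R) : 0 <= t ->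
  (2 `^ (2 * t) * cbin_ratio t) `^ c = 4 `^ c `^ t * cbin_ratio t `^ c.
Proof.
move=> t0; have := cbin_ratio_gt0 t0; move: (cbin_ratio t) => r /ltW r0.
rewrite (powRM _ (powR_ge0 _ _) r0).
have -> // : (2 `^ (2 * t)) `^ c = 4 `^ c `^ t :> R.
have e4 : 4 = 2 `^ 2%:R :> R by rewrite powR_mulrn//; ring.
by rewrite e4 -!powRrM; congr powR; ring.
Qed.

(** The law is the pushforward of the uniform law on [0, 1] by [4^c Q^q], with [Q] the quantile
    function for step [1/q]: its moment of order [p / q] involves only the integer moment [Q^p]. *)
Lemma cbin_ratio_root_law (c : R) (q : nat) : 0 < c -> (0 < q)%N ->
  exists nu : {measure set (measurableTypeR R) -> \bar R},
    nu `]-oo, 0[%classic = 0%E /\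
    forall p : nat, (\int[nu]_(x in `[0%R, +oo[) (x `^ (p%:R / q%:R))%:E =
      ((2 `^ (2 * (p%:R / q%:R)) * cbin_ratio (p%:R / q%:R)) `^ c)%:E)%E.
Proof.
move=> c0 q0.
have q0' : 0 < q%:R^-1 :> R by rewrite invr_gt0 ltr0n.
have [|Q [Qnd Q01 Qm]] := hausdorff_quantile (completely_monotone_cbin_ratio_powR q0' c0).
  by rewrite mul0r cbin_ratio0 powR1.
have Q0 u : 0 <= Q u by case/andP: (Q01 u).
have mQ : measurable_fun setT Q by apply: nondecreasing_measurable.
pose f u : R := 4 `^ c * Q u ^+ q.
have mf : measurable_fun setT f.
  by apply: measurable_funM => //; apply: (measurableT_comp (exprn_measurable q)).
pose X : {mfun (measurableTypeR R) >-> (measurableTypeR R)} :=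
  @mfun_Sub _ _ (measurableTypeR R) (measurableTypeR R) f (mem_set mf).
pose P := uniform_prob (@ltr01 R).
have Xneg : distribution P X `]-oo, 0[%classic = 0%E.
  rewrite /distribution /pushforward (_ : _ @^-1` _ = set0) ?measure0//.
  apply/seteqP; split => // u /=; rewrite in_itv/=.
  by rewrite ltNge mulr_ge0 ?powR_ge0 ?exprn_ge0.
exists (distribution P X); split=> // p.
have mpow : measurable_fun setT (fun x : R => (x `^ (p%:R / q%:R))%:E).
  by apply/measurable_EFinP; exact: measurable_powR.
rewrite -(@integral_null_setC R _ (measurableTypeR R)) => //; last first.
  by rewrite setC_itv_nneg.
rewrite ge0_integral_distribution//; last by move=> x; rewrite lee_fin powR_ge0.
rewrite integral_uniform//; first last.
- by move=> x; rewrite lee_fin powR_ge0.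
- exact: measurableT_comp.
rewrite subr0 invr1 mul1e.
have E u : (X u) `^ (p%:R / q%:R) = 4 `^ c `^ (p%:R / q%:R) * Q u ^+ p.
  rewrite powRM ?powR_ge0 ?exprn_ge0//; congr (_ * _).
  by rewrite -(powR_mulrn q)// -powRrM mulrC divfK ?powR_mulrn// pnatr_eq0 -lt0n.
under eq_integral do rewrite /= E.
have iQ : leb.-integrable `[0, 1] (EFin \o (fun u => Q u ^+ p)).
  apply: (@itv_bounded_integrable R _ _ _ _ _ 1).
    exact: (measurableT_comp (exprn_measurable p)).
  by move=> u; rewrite ger0_norm ?exprn_ge0// exprn_ile1//; case/andP: (Q01 u).
under eq_integral do rewrite EFinM.
rewrite integralZl//.
rewrite cbin_ratio_powR_split ?divr_ge0//.
by rewrite EFinM -Qm /Rintegral fineK// integrable_fin_num.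
Qed.

Lemma Stieltjes_moment_setT (mu : {measure set (measurableTypeR R) -> \bar R}) m :
  has_Stieltjes_moments mu m -> forall n, (\int[mu]_x (x ^+ n)%:E = (m n)%:E)%E.
Proof.
move=> [mu0 muE] n; rewrite -muE.
apply: (@integral_null_setC R _ (measurableTypeR R)) => //.
- by rewrite setC_itv_nneg.
- by apply/measurable_EFinP; exact: exprn_measurable.
Qed.

Lemma powR_le_1DX (x r : R) N : 0 <= x -> 0 <= r <= N%:R -> x `^ r <= 1 + x ^+ N.
Proof.
move=> x0 /andP[r0 rN]; have [x1|x1] := leP x 1.
  rewrite (@le_trans _ _ 1)// ?lerDl ?exprn_ge0//.
  have <- : 1 `^ r = 1 :> R by rewrite powR1.
  by rewrite ge0_ler_powR ?nnegrE.
by rewrite (@le_trans _ _ (x ^+ N)) ?lerDr// -powR_mulrn// ler_powR// ltW.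
Qed.

Lemma rational_above (s e : R) : 0 <= s -> 0 < e ->
  exists p q : nat, (0 < q)%N /\ s < p%:R / q%:R < s + e.
Proof.
move=> s0 e0; have [|r] := @rat_in_itvoo R s (s + e); first by rewrite ltrDl.
rewrite in_itv/= => /andP[sr rs].
have r0 : 0 < r by rewrite -(ltr0q R) (le_lt_trans s0 sr).
exists `|numq r|%N, `|denq r|%N; split; first by rewrite absz_gt0 denq_neq0.
have E (z : int) : 0 < z -> (`|z|%N)%:R = z%:~R :> R.
  by move=> z0; rewrite -{2}(gtz0_abs z0).
by rewrite !E ?numq_gt0 ?denq_gt0// -/(ratr r) sr.
Qed.

Section power_moments.
Variable c : R.
Hypothesis c0 : 0 < c.
Notation Bc := (fun n => central_binomial R n `^ c).

Lemma Stieltjes_moment_central_binomial_powR : Stieltjes_moment_sequence Bc.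
Proof.
have [nu [nu0 nuE]] := cbin_ratio_root_law c0 (ltn0Sn 0).
exists nu; split=> // n.
rewrite -central_binomial_powR_E; have := nuE n; rewrite divr1 => <-.
apply: eq_integral => x; rewrite inE /= in_itv/= andbT => x0.
by rewrite powR_mulrn.
Qed.

Lemma central_binomial_powR_determinate
    (mu nu : {measure set (measurableTypeR R) -> \bar R}) :
  has_Stieltjes_moments mu Bc -> has_Stieltjes_moments nu Bc ->
  forall A, measurable A -> mu A = nu A.
Proof.
move=> hmu hnu; apply: (@moment_determinacy R mu nu Bc (4 `^ c)).
- exact: powR_ge0.
- move=> n; rewrite -powR_mulrn ?powR_ge0// powRAC ge0_ler_powR ?nnegrE ?(ltW c0)//.
  by rewrite powR_mulrn// central_binomial_le.
- exact: Stieltjes_moment_setT.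
- exact: Stieltjes_moment_setT.
Qed.

Variable mu : {measure set (measurableTypeR R) -> \bar R}.
Hypothesis hmu : has_Stieltjes_moments mu Bc.

(** The orders [p = n q] show that the law built for [q] has moments [B_n^c]; determinacy then
    equates it with [mu], which inherits the other orders. *)
Lemma mellin_rational (p q : nat) : (0 < q)%N ->
  (\int[mu]_(x in `[0%R, +oo[) (x `^ (p%:R / q%:R))%:E =
      ((2 `^ (2 * (p%:R / q%:R)) * cbin_ratio (p%:R / q%:R)) `^ c)%:E)%E.
Proof.
move=> q0; have [nu [nu0 nuE]] := cbin_ratio_root_law c0 q0.
have hnu : has_Stieltjes_moments nu Bc.
  split=> // n; rewrite -central_binomial_powR_E.
  have := nuE (n * q)%N; rewrite natrM mulfK ?pnatr_eq0 -?lt0n// => <-.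
  apply: eq_integral => x; rewrite inE /= in_itv/= andbT => x0.
  by rewrite powR_mulrn.
rewrite -nuE; apply: eq_measure_integral => A mA _.
exact: (central_binomial_powR_determinate hmu hnu).
Qed.

Lemma mellin_central_binomial_powR (s : R) : 0 <= s ->
  (\int[mu]_(x in `[0%R, +oo[) (x `^ s)%:E =
      ((2 `^ (2 * s) * cbin_ratio s) `^ c)%:E)%E.
Proof.
(* The case [s = 0] is apart: [x^d] tends to 0 at [x = 0], whereas [0^0] is 1, so approximation from
   the right would fail at that point. *)
rewrite le_eqVlt => /predU1P[<-|s0].
  by have := @mellin_rational 0 1 isT; rewrite mul0r.
have sge0 := ltW s0.
(* The exponents stay below [s + 1], so [1 + x^N] dominates all the powers and is integrable by the
   moments of order 0 and [N]. *)
have [N sN] : exists N : nat, s + 1 <= N%:R.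
  by exists (Num.bound (s + 1)); rewrite ltW// archi_boundP// addr_ge0.
have /choice[w hw] : forall k, exists w : nat * nat,
    (0 < w.2)%N /\ s < w.1%:R / w.2%:R < s + k.+1%:R^-1.
  move=> k; have [|p [q pq]] := @rational_above s k.+1%:R^-1 sge0; first by rewrite invr_gt0.
  by exists (p, q).
pose d k : R := (w k).1%:R / (w k).2%:R - s.
have d0 k : 0 < d k <= k.+1%:R^-1.
  by have [_ /andP[? ?]] := hw k; rewrite subr_gt0 lerBlDl ltW ?andbT.
have d1 k : 0 <= d k <= 1.
  have /andP[/ltW -> /le_trans] := d0 k; apply.
  by rewrite invf_le1// ler1n.
have dE k : (w k).1%:R / (w k).2%:R = s + d k by rewrite /d addrC subrK.
have dc : d @ \oo --> (0 : R).
  apply: (squeeze_cvgr _ (@cvg_cst _ (0 : R) _ \oo _) (@cvg_harmonic R)).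
  by apply: nearW => k; have /andP[/ltW -> ->] := d0 k.
pose D : set (measurableTypeR R) := `[0%R, +oo[%classic.
have mD : measurable D by exact: measurable_itv.
have iX n : mu.-integrable D (EFin \o (fun x : R => x ^+ n)).
  apply/integrableP; split.
    by apply/measurable_EFinP/measurable_funTS; exact: exprn_measurable.
  under eq_integral => x.
    rewrite inE /D /= in_itv/= andbT => x0.
    rewrite ger0_norm ?exprn_ge0//; over.
  by case: hmu => _ ->; rewrite ltry.
have lhs : (fun k => \int[mu]_(x in D) (x `^ (s + d k))%:E)%E @ \oo -->
    (\int[mu]_(x in D) (x `^ s)%:E)%E.
  apply: (@dominated_cvg _ _ _ mu D mD (fun k x => (x `^ (s + d k))%:E) _
    (fun x => (1 + x ^+ N)%:E)) => //.
  - by move=> k; apply/measurable_EFinP/measurable_funTS; exact: measurable_powR.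
  - move=> x; rewrite /D /= in_itv/= andbT le_eqVlt => /predU1P[<-|x0].
      have E k : (0 `^ (s + d k))%:E = (0 `^ s)%:E :> \bar R.
        by rewrite !powR0// gt_eqF// addr_gt0//; have /andP[] := d0 k.
      by under eq_fun do rewrite E; exact: cvg_cst.
    apply/cvg_EFin; first exact: nearW.
    have -> : fine \o (fun k => (x `^ (s + d k))%:E) = fun k => x `^ s * x `^ d k.
      by apply/funext => k /=; rewrite powRD// (gt_eqF x0) implybT.
    by rewrite -[X in _ --> X]mulr1; apply: cvgMr; exact: powR_exponent_cvg.
  - exact: (integrableD mD (iX 0%N) (iX N)).
  - move=> k x; rewrite /D /= in_itv/= andbT => x0.
    rewrite lee_fin ger0_norm ?powR_ge0// powR_le_1DX//.
    by have /andP[? ?] := d1 k; rewrite addr_ge0//= (le_trans _ sN)// lerD2l.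
have pos (t : R) : 0 <= t -> 0 < 2 `^ (2 * t) * cbin_ratio t.
  by move=> t0; rewrite mulr_gt0 ?powR_gt0 ?cbin_ratio_gt0.
have rhs : (fun k => (2 `^ (2 * (s + d k)) * cbin_ratio (s + d k)) `^ c) @ \oo -->
    (2 `^ (2 * s) * cbin_ratio s) `^ c.
  apply: powR_base_cvg; [exact: pos| |].
    by move=> k; apply: pos; have /andP[? _] := d1 k; rewrite addr_ge0.
  apply: cvgM; last exact: cbin_ratio_right_cvg.
  apply: (@eq_cvgn _ _ (fun k => 2 `^ (2 * s) * 2 `^ (2 * d k))).
    by move=> k; rewrite mulrDr powRD// pnatr_eq0 implybT.
  rewrite -[X in _ --> X]mulr1; apply: cvgMr; apply: powR_exponent_cvg => //.
  by rewrite -(mulr0 (2 : R)); exact: cvgMr.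
have E k : (\int[mu]_(x in D) (x `^ (s + d k))%:E =
    ((2 `^ (2 * (s + d k)) * cbin_ratio (s + d k)) `^ c)%:E)%E.
  by rewrite -dE; apply: mellin_rational; case: (hw k).
rewrite (funext E) in lhs; apply: (cvg_unique _ lhs) => //.
by apply: cvg_EFin; [exact: nearW|exact: rhs].
Qed.

End power_moments.
End power_laws.

(** * The moment generating function and the Bessel series *)

Section generating_function.
Context {R : realType}.

Lemma series_even_terms (u v : nat -> R) (l : R) :
  (forall k, odd k -> u k = 0) -> (forall j, u (2 * j)%N = v j) ->
  (fun N => \sum_(k < N) u k) @ \oo --> l -> series v @ \oo --> l.
Proof.
move=> u0 uv ul.
have E n : series v n = \sum_(k < 2 * n) u k.
  rewrite /series /= big_mkord; elim: n => [|n IH]; first by rewrite !big_ord0.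
  rewrite mulnS !addSn add0n !big_ord_recr /= -IH -uv.
  by rewrite (u0 (2 * n).+1) ?addr0//= oddM.
rewrite (funext E); move=> A /ul [N _ NA]; exists N => // n /= Nn.
by apply: NA => /=; lia.
Qed.

Variable mu : {measure set (measurableTypeR R) -> \bar R}.
Hypothesis mom : forall n, (\int[mu]_x (x ^+ n)%:E = (central_binomial R n)%:E)%E.

Let K0 : 0 <= 4 :> R. Proof. by []. Qed.
Let mK n : central_binomial R (2 * n) <= 4 ^+ (2 * n).
Proof. exact: central_binomial_le. Qed.
(** 5 is an arbitrary bound strictly above 4, beyond which there is no mass. *)
Let KL : 4 < 5 :> R. Proof. by rewrite ltr_nat. Qed.

Lemma mgf_series t :
  series (fun n => central_binomial R n * (t ^+ n / n`!%:R)) @ \oo -->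
  \int[mu]_(x in `[- 5, 5]) expR (t * x).
Proof.
have := @exp_moment_series R mu _ mom 5 0 t.
under eq_Rintegral do rewrite subr0.
apply: cvg_trans; apply: near_eq_cvg; apply: nearW => N.
rewrite /series /= big_mkord; apply: eq_bigr => k _.
under eq_Rintegral do rewrite subr0.
by rewrite (moment_truncated mom K0 mK _ KL) mulrC.
Qed.

(** Centring at the midpoint 2 kills the odd moments and produces the factor [expR (2 * t)]. The
    term of order [2j] is [t^(2j) C(2j,j) / (2j)! = t^(2j) / (j!)^2], the general term of the Bessel
    series at [2t]. *)
Lemma mgf_bessel t :
  \int[mu]_(x in `[- 5, 5]) expR (t * x) = expR (2 * t) * besselI 0 (2 * t).
Proof.
have c := @exp_moment_series R mu _ mom 5 2 t.
pose v k : R := (2 * t / 2) ^+ (2 * k + 0) / (k`!%:R * Gamma (k%:R + 0%:R + 1)).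
have /(cvg_lim (@Rhausdorff R)) E : series v @ \oo -->
    \int[mu]_(x in `[- 5, 5]) expR (t * (x - 2)).
  apply: (@series_even_terms (fun k => t ^+ k / k`!%:R *
    \int[mu]_(x in `[- 5, 5]) ((x - 2) ^+ k)) v _ _ _ c) => [k ok|j].
    by rewrite (shifted_moment mom K0 mK KL 2 k) sum_central_binomial_shift ok mulr0.
  rewrite (shifted_moment mom K0 mK KL 2) sum_central_binomial_shift oddM /= mul2n doubleK -mul2n /v addr0 natr1 Gamma_nat addn0.
  have -> : 2 * t / 2 = t by field.
  have <- := @bin_fact (2 * j) j ltac:(lia).
  have -> : (2 * j - j = j)%N by lia.
  rewrite !natrM; field.
  by rewrite !pnatr_eq0 -!lt0n fact_gt0 bin_gt0; lia.
rewrite /besselI -/v E -RintegralZl//; last exact: (exp_moment_integrable mom).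
by apply: eq_Rintegral => x _; rewrite -expRD; congr expR; ring.
Qed.

End generating_function.

(** * From random variables to their laws *)

Section random_variable.
Context {R : realType} (d : measure_display) (T : measurableType d)
  (P : probability T R) (X : {RV P >-> measurableTypeR R}).

(** A finite value of the expectation forces absolute integrability, the condition for the change of
    variables when [x^n] changes sign. *)
Lemma distribution_moment n (m : R) :
  ('E_P[fun w => ((X w : R) ^+ n)%R] = m%:E)%E ->
  (\int[distribution P X]_x (x ^+ n)%:E = m%:E)%E.
Proof.
rewrite unlock => E.
have mXn : measurable_fun setT (fun w => (X w : R) ^+ n).
  exact: (measurableT_comp (exprn_measurable n) (measurable_funPT X)).
rewrite integral_distribution//.
- by apply/measurable_EFinP; exact: exprn_measurable.
- apply/integrableP; split; first exact/measurable_EFinP.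
  by have := integral_fin_num_abs P measurableT mXn; rewrite E /= => ->.
Qed.

Lemma mmt_gen_fun_distribution t :
  mmt_gen_fun P X t = (\int[distribution P X]_x (expR (t * x))%:E)%E.
Proof.
rewrite /mmt_gen_fun unlock ge0_integral_distribution//.
- by apply: eq_integral => w _ /=; rewrite mulrC.
- apply/measurable_EFinP; apply: measurableT_comp => //.
Qed.

End random_variable.

Theorem theorem2 (R : realType) :
  [/\ infinitely_divisible_Stieltjes (@central_binomial R),
      forall (d : measure_display) (T : measurableType d)
             (P : probability T R) (X : {RV P >-> R}),
        (forall n : nat,
           ('E_P[fun w => (X w ^+ n)%R])%E = (central_binomial R n)%:E) ->
        has_density X
          (fun x : R => if (0 < x) && (x < 4)
                        then pi^-1 * (Num.sqrt (x * (4 - x)))^-1 else 0) /\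
        forall t : R,
          mmt_gen_fun P X t = (expR (2 * t) * besselI 0 (2 * t))%:E /\
          series (fun n : nat => central_binomial R n * (t ^+ n / n`!%:R)) @ \oo
            --> expR (2 * t) * besselI 0 (2 * t),
      forall c : R, 0 < c ->
        Stieltjes_determinate (fun n => central_binomial R n `^ c) &
      forall c : R, 0 < c ->
        forall mu : {measure set (measurableTypeR R) -> \bar R},
          has_Stieltjes_moments mu (fun n => central_binomial R n `^ c) ->
          forall s : R, 0 <= s ->
            (\int[mu]_(t in `[0%R, +oo[) (t `^ s)%:E)%E =
              ((2 `^ (2 * s) / Num.sqrt pi
                * (Gamma (s + 2^-1) / Gamma (s + 1))) `^ c)%:E /\
            (2 `^ (2 * s) / Num.sqrt pi
              * (Gamma (s + 2^-1) / Gamma (s + 1))) `^ c =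
              (Gamma (2 * s + 1) / Gamma (s + 1) ^+ 2) `^ c].
Proof.
split.
- split; last by move=> c; exact: Stieltjes_moment_central_binomial_powR.
  have := Stieltjes_moment_central_binomial_powR (@ltr01 R).
  rewrite (_ : (fun n => _) = @central_binomial R)//.
  by apply/funext => n; rewrite powRr1// /central_binomial.
- move=> d T P X E.
  (* [X'] is [X] itself, with the reals carrying the Borel structure on which the measures above are
     defined. *)
  pose X' : {RV P >-> measurableTypeR R} :=
    @mfun_Sub _ _ T (measurableTypeR R) X (mem_set (measurable_funPT X)).
  have mom n : (\int[distribution P X']_x (x ^+ n)%:E = (central_binomial R n)%:E)%E.
    exact: (distribution_moment (X := X') (E n)).
  split.
    split; [exact: measurable_arcsine_pdf|exact: arcsine_pdf_ge0|].
    by move=> A mA; exact: (arcsine_law mom).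
  move=> t; split.
    rewrite (mmt_gen_fun_distribution X') -(mgf_bessel mom).
    apply: (@exp_moment_truncated _ _ _ 4 mom) => //.
    + by move=> n; exact: central_binomial_le.
    + by rewrite ltr_nat.
  by rewrite -(mgf_bessel mom); exact: mgf_series.
- move=> c c0; split; first exact: Stieltjes_moment_central_binomial_powR.
  exact: central_binomial_powR_determinate.
- move=> c c0 mu hmu s s0; rewrite -cbin_ratio_duplication//; split=> //.
  by rewrite cbin_ratio_gammaE; exact: mellin_central_binomial_powR.
Qed.
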